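(* Fix a supervised example $(x^*,y^* )$ and $q\in[0,1]$. Draw $z^{(1)},\dots,z^{(M)}$ i.i.d. from $p_\theta(\cdot\mid x^* )$ and set $$w_m\triangleq p_\theta(y^*\mid x^*,z^{(m)})\in[0,1],\qquad g_m\triangleq-w_m\,\nabla_\theta\log p_\theta(z^{(m)},y^*\mid x^* ),$$ $\bar w_M=\frac1M\sum_mw_m$, $\bar g_M=\frac1M\sum_mg_m$, and the estimator $\hat\nabla_\theta\ell_q\triangleq\bar g_M/(\bar w_M)^q$. Assume (1) $P_\theta>0$; (2) $\mathbb{E}[\|g_m\|^2]<\infty$; (3) $w_m\ge\varepsilon$ almost surely for some $\varepsilon>0$; and that differentiation and summation over $z$ may be interchanged, so that $\mathbb{E}[w_m]=P_\theta$ and $\mathbb{E}[g_m]=-\nabla_\theta P_\theta$. Then $\hat\nabla_\theta\ell_q\to\nabla_\theta\ell_q$ almost surely as $M\to\infty$, and $$\mathbb{E}\big[\hat\nabla_\theta\ell_q\big]-\nabla_\theta\ell_q=\frac{q}{M\,P_\theta^{q+1}}\left[\frac{q+1}{2}\,\nabla_\theta\ell_1\,\mathrm{Var}(w_m)-\mathrm{Cov}(g_m,w_m)\right]+O(M^{-2})\quad(M\to\infty),$$ where $\nabla_\theta\ell_1=-\nabla_\theta\log P_\theta$ and $\mathrm{Cov}(g_m,w_m)=\mathbb{E}[(g_m-\mathbb{E}g_m)(w_m-\mathbb{E}w_m)]\in\mathbb{R}^d$. Moreover, if in addition $\|\nabla_\theta\log P_\theta\|\le C$ and $\|\nabla_\theta\log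 p_\theta(z,y^*\mid x^* )\|\le C'$ for all $z$, then the leading term has norm at most $(C+C')\,\dfrac{q}{M\,P_\theta^{q}}$; i.e. the bias is $O\!\big(q/(MP_\theta^q)\big)+O(M^{-2})$. For $q=0$ the estimator is exactly unbiased for every $M$.
   Context: $p_\theta$ is a model with parameters $\theta\in\mathbb{R}^d$ that samples a latent $z$ (from a countable set) from $p_\theta(\cdot\mid x)$ and an output from $p_\theta(\cdot\mid x,z)$; $P_\theta\triangleq p_\theta(y^*\mid x^* )=\sum_z p_\theta(z,y^*\mid x^* )$. The Tsallis $q$-logarithm is $\log_q(u)=\frac{u^{1-q}-1}{1-q}$ ($q<1$), $\log_1(u)=\log u$, and $\ell_q\triangleq-\log_q P_\theta$, so $\nabla_\theta\ell_q=-P_\theta^{-q}\nabla_\theta P_\theta$. *)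

(* Defs.v *)
From HB Require Import structures.
From mathcomp Require Import all_boot all_order all_algebra.
From mathcomp Require Import all_classical all_reals all_analysis.

Set Implicit Arguments.
Unset Strict Implicit.
Unset Printing Implicit Defensive.

Import Order.TTheory GRing.Theory Num.Theory.
Import numFieldNormedType.Exports.

Local Open Scope classical_set_scope.
Local Open Scope ring_scope.

Section calculus.
Context {R : realType} {d : nat}.

Definition enorm (v : 'rV[R]_d) : R := Num.sqrt (\sum_(i < d) v 0 i ^+ 2).

Definition partial (i : 'I_d) (f : 'rV[R]_d -> R) (a : 'rV[R]_d) : R :=
  derive f a (delta_mx 0 i).

Definition partials_exist (f : 'rV[R]_d -> R) (a : 'rV[R]_d) : Prop :=
  forall i : 'I_d, derivable f a (delta_mx 0 i).

Definition grad (f : 'rV[R]_d -> R) (a : 'rV[R]_d) : 'rV[R]_d :=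
  \row_i partial i f a.

End calculus.

(* Tsallis q-logarithm: log_q u = (u^(1-q) - 1)/(1-q) for q <> 1, log_1 = log. *)
Definition logq {R : realType} (q u : R) : R :=
  if q == 1 then ln u else (u `^ (1 - q) - 1) / (1 - q).

(* The countable latent space is (w.l.o.g.) nat.                        *)
(*   pz th z = p_theta(z | x_star),   py th z = p_theta(y_star | x_star, z).        *)
Section model.
Context {R : realType} {d : nat}.
Variables (pz py : 'rV[R]_d -> nat -> R).

Definition joint (th : 'rV[R]_d) (z : nat) : R := pz th z * py th z.

(* (the terms are nonnegative in the model, so the extended-real sum is
   the usual value of the series) *)
Definition marginal (th : 'rV[R]_d) : R :=
  fine (\sum_(0 <= z <oo) (joint th z)%:E)%E.

Definition ell (q : R) (th : 'rV[R]_d) : R := - logq q (marginal th).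

End model.

(* Sampling: z^(m+1) = Zs m, random variables Omega -> nat.            *)
Section sampling.
Context {R : realType} {dO : measure_display} {Omega : measurableType dO}.
Variable (Pr : probability Omega R).

Definition mutually_independent (Zs : nat -> Omega -> nat) : Prop :=
  forall (s : seq nat), uniq s -> forall (A : nat -> set nat),
    Pr (\bigcap_(m in [set` s]) (Zs m @^-1` A m)) =
    (\prod_(m <- s) Pr (Zs m @^-1` A m))%E.

Definition Evec (n : nat) (X : Omega -> 'rV[R]_n) : 'rV[R]_n :=
  \row_i fine ('E_Pr[fun om => X om ord0 i])%E.

Definition Covvec (n : nat) (X : Omega -> 'rV[R]_n) (Y : Omega -> R) : 'rV[R]_n :=
  \row_i fine (covariance Pr (fun om => X om ord0 i) Y).

End sampling.

Section estimator.
Context {R : realType} {d : nat} {Omega : Type}.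
Variables (pz py : 'rV[R]_d -> nat -> R) (theta : 'rV[R]_d)
          (Zs : nat -> Omega -> nat).

Definition wm (m : nat) (om : Omega) : R := py theta (Zs m om).

Definition gm (m : nat) (om : Omega) : 'rV[R]_d :=
  - wm m om *: grad (fun th => ln (joint pz py th (Zs m om))) theta.

Definition wbar (M : nat) (om : Omega) : R := (M%:R)^-1 * \sum_(m < M) wm m om.
Definition gbar (M : nat) (om : Omega) : 'rV[R]_d :=
  (M%:R)^-1 *: \sum_(m < M) gm m om.

Definition estimator (q : R) (M : nat) (om : Omega) : 'rV[R]_d :=
  (wbar M om `^ q)^-1 *: gbar M om.

End estimator.

(* Main.v *)
(* By independence each g_m is uncorrelated with functions of the other samples, so
   E[g_m f(wbar)] is expanded at the leave-one-out mean
   a = P + (1/M) sum_(j <> m) (w_j - P): from wbar = a + (w_m - P)/M and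
   f(x) = x^(-q) one gets
     E[g_m f(wbar)] = E[g] E[f(a)] + Cov(g, w) E[f'(a)] / M + O(M^-2),
   which needs only an integrable g since |w_m - P| <= 1. A fourth-order Taylor
   expansion gives E[f(a)] = f(P) + f''(P) Var(w) / (2M) + O(M^-2), because the
   third and fourth central moments of a are O(M^-2); similarly
   E[f'(a)] = f'(P) + O(1/M). Almost sure convergence is the strong law for
   square-integrable variables. Latents of probability zero contribute nothing to
   the gradient: there the joint density vanishes at theta, which is a minimum. *)
Require Import Defs.
From HB Require Import structures.
From mathcomp Require Import all_boot all_order all_algebra.
From mathcomp Require Import ring lra zify.
From mathcomp Require Import all_classical all_reals all_analysis.
From mathcomp Require Import measurable_realfun.
Set Implicit Arguments.
Unset Strict Implicit.
Unset Printing Implicit Defensive.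
Import Order.TTheory GRing.Theory Num.Theory.
Import numFieldNormedType.Exports.
Local Open Scope classical_set_scope.
Local Open Scope ring_scope.

(** * Taylor estimates and directional derivatives *)

(** The fourth order is forced: stopping at the cubic remainder and taking absolute values leaves
    only O(M^(-3/2)), so the cubic term is kept, its signed expectation being O(M^-2) because third
    central moments add up under independence. The bounds on the weights hold only on latents of
    positive probability, while the Taylor estimates need every weight and mean in [[eps], 1], where
    powers have uniform constants. The analysis therefore runs on weights and gradient samples
    altered on null latents, and returns to the estimator by almost sure equality. Every variable is
    a function of nat-valued samples. Measurability is then automatic, independence reduces to
    events that fix values, and an expectation is a series over latents in their natural order, the
    form in which the interchange hypothesis is given. Consistency and bias are treated coordinate
    by coordinate. The bound on the leading term cannot be, since its constant must not depend on
    the dimension. *)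

Section taylor.
Context {R : realType}.
Variables (lo hi : R).
Hypothesis lo0 : 0 < lo.

(** Mean value theorem: [f y] is [df c * (y - x)] with [c] between [x] and [y], so a bound on the
    derivative gains one order. It drives all the Taylor estimates below. *)
Lemma is_derive_growth (n : nat) (x K : R) (f df : R -> R) :
  lo <= x <= hi -> f x = 0 ->
  (forall y : R, 0 < y -> is_derive y 1 f (df y)) ->
  (forall y, lo <= y <= hi -> `|df y| <= K * `|y - x| ^+ n) ->
  forall y, lo <= y <= hi -> `|f y| <= K * `|y - x| ^+ n.+1.
Proof.
move=> /andP[lox xhi] fx0 fd dfK y /andP[loy yhi].
have cont (a b : R) : 0 < a -> {within `[a, b], continuous f}.
  move=> a0; apply: continuous_in_subspaceT => z.
  rewrite inE/= in_itv/= => /andP[az _].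
  apply: differentiable_continuous; apply/derivable1_diffP.
  by have [] := fd z (lt_le_trans a0 az).
have fdI (a b : R) : 0 < a -> forall z : R, z \in `]a, b[ -> is_derive z 1 f (df z).
  by move=> a0 z; rewrite in_itv/= => /andP[az _]; exact/fd/lt_trans/az.
(* The sign of [K] is not assumed: the bound on [df] at [y] forces it unless [y = x]. *)
have K0 : 0 <= K \/ y = x.
  have [->|yx] := eqVneq y x; [by right|left].
  have /dfK : lo <= y <= hi by rewrite loy.
  move=> /(le_trans (normr_ge0 _)); rewrite pmulr_lge0//.
  by rewrite exprn_gt0// normr_gt0 subr_eq0.
have key c : lo <= c <= hi -> `|c - x| <= `|y - x| ->
    `|df c * (y - x)| <= K * `|y - x| ^+ n.+1.
  move=> cI cyx; rewrite normrM exprSr mulrA ler_wpM2r//.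
  apply: le_trans (dfK _ cI) _.
  case: K0 => [K0|yx]; first by rewrite ler_wpM2l// lerXn2r ?nnegrE.
  by move: cyx; rewrite yx subrr normr0 normr_le0 => /eqP ->; rewrite normr0.
have [xy|yx] := leP x y.
  have [c] := @MVT_segment R f df x y xy
    (fdI x y (lt_le_trans lo0 lox)) (cont x y (lt_le_trans lo0 lox)).
  rewrite in_itv/= => /andP[xc cy]; rewrite fx0 subr0 => ->.
  apply: key; first by rewrite (le_trans lox xc) (le_trans cy yhi).
  by rewrite !ger0_norm ?subr_ge0// lerD2r.
have [c] := @MVT_segment R f df y x (ltW yx)
  (fdI y x (lt_le_trans lo0 loy)) (cont y x (lt_le_trans lo0 loy)).
rewrite in_itv/= => /andP[yc cx]; rewrite fx0 sub0r => E.
have -> : f y = df c * (y - x) by rewrite -[f y]opprK E -mulrN opprB.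
apply: key; first by rewrite (le_trans loy yc) (le_trans cx xhi).
by rewrite (distrC c) (distrC y) !ger0_norm ?subr_ge0 ?(ltW yx)// lerD2l lerN2.
Qed.

(** Powers are monotone, in a direction given by the sign of [r]; the sum of the two endpoint values
    serves both cases. *)
Lemma powR_bounded (r : R) :
  exists K, forall y, lo <= y <= hi -> `|y `^ r| <= K.
Proof.
exists (lo `^ r + hi `^ r) => y /andP[loy yhi].
have y0 := lt_le_trans lo0 loy.
rewrite ger0_norm ?powR_ge0//.
have [r0|r0] := leP 0 r.
  apply: ler_wpDl; first exact: powR_ge0.
  by apply: ge0_ler_powR => //; rewrite nnegrE ltW// (lt_le_trans y0).
apply: ler_wpDr; first exact: powR_ge0.
rewrite -[r]opprK powRN [lo `^ _]powRN lef_pV2 ?posrE ?powR_gt0//.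
by apply: ge0_ler_powR; rewrite ?nnegrE ?oppr_ge0 ?(ltW r0) ?(ltW lo0) ?(ltW y0).
Qed.

(** Removes one monomial of a Taylor polynomial; applied repeatedly, it differentiates a whole
    remainder. *)
Lemma is_derive_subm (f : R -> R) (df z c x : R) n : is_derive z 1 f df ->
  is_derive z 1 (fun y => f y - c * (y - x) ^+ n.+1)
    (df - c * n.+1%:R * (z - x) ^+ n).
Proof.
move=> fd; have -> : (fun y => f y - c * (y - x) ^+ n.+1) =
  f - c *: ((id - cst x) ^+ n.+1).
  apply/funext => y; by rewrite !fctE.
have := is_deriveB fd (is_deriveZ c (is_deriveX n.+1
  (is_deriveB (is_derive_id z (1 : R)) (is_derive_cst x z 1)))).
set D := (X in is_derive _ _ _ X -> _) => H.
have <- // : D = df - c * n.+1%:R * (z - x) ^+ n.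
by rewrite /D /GRing.scale/= subr0 !fctE/= mulr1 mulrA.
Qed.

Lemma is_derive_powRB (r z c : R) : 0 < z ->
  is_derive z 1 (fun y => y `^ r - c) (r * z `^ (r - 1)).
Proof.
move=> z0; have := is_deriveB (is_derive1_powR r z0) (is_derive_cst c z 1).
by rewrite subr0.
Qed.

(** From here on, the remainder at exponent [r] vanishes at [x] and its derivative is [r] times the
    remainder of one order less at exponent [r - 1]. The constant is uniform in the base point [x],
    which will be random. *)
Lemma powR_taylor1 (r : R) : exists2 K, 0 <= K &
  forall x y, lo <= x <= hi -> lo <= y <= hi ->
  `|y `^ r - x `^ r| <= K * `|y - x| ^+ 1.
Proof.
have [K0 HK] := powR_bounded (r - 1).
exists (`|r| * `|K0|); first by rewrite mulr_ge0.
move=> x y xI yI.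
apply: (@is_derive_growth 0 x _ (fun y => y `^ r - x `^ r)
         (fun y => r * y `^ (r - 1))) => //.
- by rewrite subrr.
- by move=> z; exact: is_derive_powRB.
- move=> z zI; rewrite expr0 mulr1 normrM ler_wpM2l//.
  exact: le_trans (HK _ zI) (ler_norm _).
Qed.

Lemma powR_taylor2 (r : R) : exists2 K, 0 <= K &
  forall x y, lo <= x <= hi -> lo <= y <= hi ->
  `|y `^ r - x `^ r - r * x `^ (r - 1) * (y - x) ^+ 1| <= K * `|y - x| ^+ 2.
Proof.
have [K0 K00 HK] := powR_taylor1 (r - 1).
exists (`|r| * K0); first by rewrite mulr_ge0.
move=> x y xI yI.
apply: (@is_derive_growth 1 x _
   (fun y => y `^ r - x `^ r - r * x `^ (r - 1) * (y - x) ^+ 1)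
   (fun y => r * (y `^ (r - 1) - x `^ (r - 1)))) => //.
- by rewrite !subrr !expr0n/= ?mulr0 ?subr0 ?mulr0 ?subr0 ?mulr0 ?subr0.
- move=> z z0; apply: is_derive_eq.
    exact/is_derive_subm/is_derive_powRB.
  by field.
- by move=> z zI; rewrite normrM -[leRHS]mulrA ler_wpM2l// HK.
Qed.

Lemma powR_taylor3 (r : R) : exists2 K, 0 <= K &
  forall x y, lo <= x <= hi -> lo <= y <= hi ->
  `|y `^ r - x `^ r - r * x `^ (r - 1) * (y - x) ^+ 1
    - r * (r - 1) * x `^ (r - 1 - 1) / 2 * (y - x) ^+ 2|
  <= K * `|y - x| ^+ 3.
Proof.
have [K0 K00 HK] := powR_taylor2 (r - 1).
exists (`|r| * K0); first by rewrite mulr_ge0.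
move=> x y xI yI.
apply: (@is_derive_growth 2 x _
   (fun y => y `^ r - x `^ r - r * x `^ (r - 1) * (y - x) ^+ 1
     - r * (r - 1) * x `^ (r - 1 - 1) / 2 * (y - x) ^+ 2)
   (fun y => r * (y `^ (r - 1) - x `^ (r - 1)
     - (r - 1) * x `^ (r - 1 - 1) * (y - x) ^+ 1))) => //.
- by rewrite !subrr !expr0n/= ?mulr0 ?subr0 ?mulr0 ?subr0 ?mulr0 ?subr0.
- move=> z z0; apply: is_derive_eq.
    exact/is_derive_subm/is_derive_subm/is_derive_powRB.
  by field.
- by move=> z zI; rewrite normrM -[leRHS]mulrA ler_wpM2l// HK.
Qed.

Lemma powR_taylor4 (r : R) : exists2 K, 0 <= K &
  forall x y, lo <= x <= hi -> lo <= y <= hi ->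
  `|y `^ r - x `^ r - r * x `^ (r - 1) * (y - x) ^+ 1
    - r * (r - 1) * x `^ (r - 1 - 1) / 2 * (y - x) ^+ 2
    - r * (r - 1) * (r - 1 - 1) * x `^ (r - 1 - 1 - 1) / 6 * (y - x) ^+ 3|
  <= K * `|y - x| ^+ 4.
Proof.
have [K0 K00 HK] := powR_taylor3 (r - 1).
exists (`|r| * K0); first by rewrite mulr_ge0.
move=> x y xI yI.
apply: (@is_derive_growth 3 x _
   (fun y => y `^ r - x `^ r - r * x `^ (r - 1) * (y - x) ^+ 1
    - r * (r - 1) * x `^ (r - 1 - 1) / 2 * (y - x) ^+ 2
    - r * (r - 1) * (r - 1 - 1) * x `^ (r - 1 - 1 - 1) / 6 * (y - x) ^+ 3)
   (fun y => r * (y `^ (r - 1) - x `^ (r - 1)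
     - (r - 1) * x `^ (r - 1 - 1) * (y - x) ^+ 1
     - (r - 1) * (r - 1 - 1) * x `^ (r - 1 - 1 - 1) / 2 * (y - x) ^+ 2))) => //.
- by rewrite !subrr !expr0n/= ?mulr0 ?subr0 ?mulr0 ?subr0 ?mulr0 ?subr0.
- move=> z z0; apply: is_derive_eq.
    exact/is_derive_subm/is_derive_subm/is_derive_subm/is_derive_powRB.
  by field.
- by move=> z zI; rewrite normrM -[leRHS]mulrA ler_wpM2l// HK.
Qed.

End taylor.

Section directional.
Context {R : realType} {V : normedModType R}.
Implicit Types (f : V -> R) (a v : V).

Lemma derive_line f a v : 'D_v f a = 'D_1 (fun h : R => f (h *: v + a)) 0.
Proof.
rewrite /derive; set g1 := fun h => h^-1 *: _; set g2 := fun h => h^-1 *: _.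
suff -> : g1 = g2 by [].
by rewrite funeqE /g1 /g2 => h /=; rewrite addr0 scale0r add0r [_%:A]mulr1.
Qed.

Lemma is_derive_line f a v df :
  is_derive a v f df <-> is_derive (0 : R) 1 (fun h : R => f (h *: v + a)) df.
Proof.
by split=> -[H1 H2]; split; [exact: (derivable1P _ _ _).1|
  rewrite -derive_line|exact: (derivable1P _ _ _).2|rewrite derive_line].
Qed.

(** Only directional derivatives are assumed to exist, so the chain rule is applied to the
    restriction of [f] to a line. *)
Lemma is_derive_comp1 f a v df (g : R -> R) dg :
  is_derive a v f df -> is_derive (f a) 1 g dg ->
  is_derive a v (g \o f) (dg * df).
Proof.
move=> /is_derive_line Hf Hg; apply/is_derive_line.
by apply: (@is_derive1_comp R g (fun h : R => f (h *: v + a))); rewrite scale0r add0r.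
Qed.

(** A difference quotient closer to a nonzero derivative L than |L| has the sign of L. At a minimum
    the quotient is nonnegative for positive steps and nonpositive for negative ones: the step -e/2
    refutes L > 0 and e/2 refutes L < 0. *)
Lemma derive_at_min f a v : derivable f a v -> (forall b, f a <= f b) ->
  'D_v f a = 0.
Proof.
move=> df fmin; apply: contrapT => /eqP L0.
move: (df) => /cvgrPdist_lt.
move=> /(_ `|'D_v f a|); rewrite normr_gt0 => /(_ L0).
rewrite near_withinE => -[e /= e0 He].
set L := 'D_v f a in L0 He.
have key h : h != 0 -> `|h| < e -> `|L - h^-1 * (f (h *: v + a) - f a)| < `|L|.
  by move=> h0 he; apply: He => //=; rewrite sub0r normrN.
have e2 : `|e / 2| < e by rewrite ger0_norm; lra.
have n2 : `|- (e / 2)| < e by rewrite normrN.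
have i2 : 0 < (e / 2)^-1 by rewrite invr_gt0; lra.
have e20 : e / 2 != 0 by apply: lt0r_neq0; lra.
have [Lp|Ln] := ltP 0 L.
  have := key (- (e / 2)); rewrite oppr_eq0 => /(_ e20 n2).
  rewrite invrN mulNr opprK.
  have := mulr_ge0 (ltW i2) (eqbRL (subr_ge0 _ _) (fmin (- (e / 2) *: v + a))).
  move=> H; rewrite !ger0_norm ?(ltW Lp)//; last by rewrite addr_ge0// ltW.
  by rewrite ltNge lerDl H.
have := key (e / 2) e20 e2.
have := mulr_ge0 (ltW i2) (eqbRL (subr_ge0 _ _) (fmin ((e / 2) *: v + a))).
move=> H; rewrite !ler0_norm// ?opprB ?subr_le0; last exact: le_trans H.
by rewrite ltNge lerDr H.
Qed.

End directional.

(** * Expectations of discrete variables and independence *)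

Section expectation_real.
Context {R : realType} {dO : measure_display} {Omega : measurableType dO}.
Variable Pr : probability Omega R.
Implicit Types X Y : Omega -> R.

Definition L1 X := Pr.-integrable setT (EFin \o X).

Lemma L1_measurable X : L1 X -> measurable_fun setT X.
Proof. by move=> /measurable_int/measurable_EFinP. Qed.

Lemma L1D X Y : L1 X -> L1 Y -> L1 (fun om => X om + Y om).
Proof.
move=> LX LY; rewrite /L1 (_ : _ \o _ = (EFin \o X) \+ (EFin \o Y))%E.
  exact: integrableD.
by apply/funext => om.
Qed.

Lemma L1Z c X : L1 X -> L1 (fun om => c * X om).
Proof.
move=> LX; rewrite /L1 (_ : _ \o _ = (fun om => c%:E * (EFin \o X) om)%E).
  exact: integrableZl.
by apply/funext => om.
Qed.

Lemma L1N X : L1 X -> L1 (fun om => - X om).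
Proof.
by move=> /(L1Z (-1)); congr L1; apply/funext => om; rewrite mulN1r.
Qed.

Lemma L1B X Y : L1 X -> L1 Y -> L1 (fun om => X om - Y om).
Proof. by move=> LX /L1N; exact: L1D. Qed.

Lemma L1_le X Y : measurable_fun setT X -> L1 Y ->
  (forall om, `|X om| <= `|Y om|) -> L1 X.
Proof.
move=> mX LY XY; apply: le_integrable LY => //.
  exact/measurable_EFinP.
by move=> om _; rewrite lee_fin.
Qed.

Lemma L1_cst c : L1 (fun=> c).
Proof. exact: finite_measure_integrable_cst. Qed.

Lemma L1_bounded X B : measurable_fun setT X -> (forall om, `|X om| <= B) ->
  L1 X.
Proof.
move=> mX XB; apply: L1_le mX (L1_cst B) _ => om.
exact: le_trans (XB om) (ler_norm _).
Qed.

Lemma L1_abs X : L1 X -> L1 (fun om => `|X om|).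
Proof.
move=> LX; apply: L1_le (LX) _; last by move=> om; rewrite normr_id.
exact/measurableT_comp/L1_measurable.
Qed.

Lemma L1_sum I (s : seq I) (X : I -> Omega -> R) :
  (forall i, L1 (X i)) -> L1 (fun om => \sum_(i <- s) X i om).
Proof.
move=> LX; elim: s => [|i s IH].
  by under eq_fun do rewrite big_nil; exact: L1_cst.
by under eq_fun do rewrite big_cons; exact: L1D.
Qed.

Lemma L1_sum_ord n (X : 'I_n -> Omega -> R) :
  (forall i, L1 (X i)) -> L1 (fun om => \sum_(i < n) X i om).
Proof. exact: L1_sum. Qed.

Local Notation "'Ex' X" := (Rintegral Pr setT X) (at level 10, X at level 8).

Lemma ExD X Y : L1 X -> L1 Y -> Ex (fun om => X om + Y om) = Ex X + Ex Y.
Proof. exact: RintegralD. Qed.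

Lemma ExB X Y : L1 X -> L1 Y -> Ex (fun om => X om - Y om) = Ex X - Ex Y.
Proof. exact: RintegralB. Qed.

Lemma ExZ c X : L1 X -> Ex (fun om => c * X om) = c * Ex X.
Proof. exact: RintegralZl. Qed.

Lemma Ex_cst c : Ex (fun=> c) = c.
Proof.
rewrite Rintegral_cst// -[RHS]mulr1; congr (_ * _).
by rewrite -[RHS]/(fine (1%E : \bar R)); congr fine; exact: probability_setT.
Qed.

Lemma Ex_sum I (s : seq I) (X : I -> Omega -> R) : (forall i, L1 (X i)) ->
  Ex (fun om => \sum_(i <- s) X i om) = \sum_(i <- s) Ex (X i).
Proof.
move=> LX; elim: s => [|i s IH].
  by under eq_Rintegral do rewrite big_nil; rewrite big_nil Ex_cst.
under eq_Rintegral do rewrite big_cons.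
by rewrite big_cons -IH ExD//; exact: L1_sum.
Qed.

Lemma Ex_le X Y : L1 X -> L1 Y -> (forall om, X om <= Y om) -> Ex X <= Ex Y.
Proof. by move=> LX LY XY; apply: le_Rintegral. Qed.

Lemma Ex_ge0 X : (forall om, 0 <= X om) -> 0 <= Ex X.
Proof. by move=> X0; apply: Rintegral_ge0. Qed.

Lemma Ex_abs X : L1 X -> `|Ex X| <= Ex (fun om => `|X om|).
Proof. by move=> LX; exact: le_normr_Rintegral. Qed.

Lemma Ex_abs_le X Y : L1 X -> L1 Y -> (forall om, `|X om| <= Y om) ->
  `|Ex X| <= Ex Y.
Proof.
by move=> LX LY XY; apply: le_trans (Ex_abs LX) _; apply: Ex_le => //; exact: L1_abs.
Qed.

Lemma Ex_EFin X : L1 X -> (Ex X)%:E = (\int[Pr]_om (X om)%:E)%E.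
Proof. by move=> LX; rewrite /Rintegral fineK//; exact: integrable_fin_num. Qed.

Lemma ae_eq_Ex X Y : measurable_fun setT X -> measurable_fun setT Y ->
  {ae Pr, forall om, X om = Y om} -> Ex X = Ex Y.
Proof.
move=> mX mY XY; congr fine; apply: ae_eq_integral => //.
- exact/measurable_EFinP.
- exact/measurable_EFinP.
by apply: filterS XY => om ->.
Qed.

Section discrete.
Variable U : Omega -> nat.
Hypothesis mU : forall A, measurable (U @^-1` A).

Lemma measurable_discrete d' (T' : measurableType d') (g : nat -> T') :
  measurable_fun setT (fun om => g (U om)).
Proof. by move=> _ B mB; rewrite setTI; exact: (mU (g @^-1` B)). Qed.

(** Decomposition along the fibers of [U]. The domain [D] is arbitrary so that it can be a fiber of
    another variable, which is how independence enters. *)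
Lemma ge0_integral_discrete (D : set Omega) (g : nat -> \bar R) :
  measurable D -> (forall n, (0 <= g n)%E) ->
  (\int[Pr]_(om in D) g (U om) =
   \sum_(0 <= n <oo) g n * Pr (D `&` U @^-1` [set n]))%E.
Proof.
move=> mD g0; pose F n := D `&` U @^-1` [set n].
have DE : D = \bigcup_n F n.
  apply/seteqP; split=> [om Dom|om [n _ []//]].
  by exists (U om).
rewrite [in LHS]DE ge0_integral_bigcup//.
- apply: eq_eseriesr => n _; rewrite -integral_cst; last exact: measurableI.
  by apply: eq_integral => om; rewrite inE => -[_ /= ->].
- by move=> n; exact: measurableI.
- exact/measurable_funTS/measurable_discrete.
- by move=> i j _ _ [om [[_ /= <-] [_ /= <-]]].
Qed.

(** Dominated convergence for the truncations to [U om < n], whose expectations are the partial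
    sums. The sign of [h] is free, so the limit is stated for the ordinary [series]. *)
Lemma Ex_discrete_series (h : nat -> R) : L1 (fun om => h (U om)) ->
  series (fun n => h n * fine (Pr (U @^-1` [set n]))) @ \oo
    --> Ex (fun om => h (U om)).
Proof.
move=> Lh.
pose g n om := h (U om) * (U om < n)%N%:R.
have gE n : Ex (g n) = series (fun n => h n * fine (Pr (U @^-1` [set n]))) n.
  have -> : g n = fun om => \sum_(0 <= k < n) h k * \1_(U @^-1` [set k]) om.
    apply/funext => om; rewrite /g.
    have [Un|nU] := ltnP (U om) n.
      rewrite big_mkord (bigD1 (Ordinal Un))//= indicE mem_set// big1 ?addr0//.
      move=> i /eqP iU; rewrite indicE memNset ?mulr0//= => E.
      by apply: iU; apply/val_inj; rewrite /= E.
    rewrite mulr0 big_nat_cond big1// => i /andP[/andP[_ iN] _].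
    rewrite indicE memNset ?mulr0//= => E.
    by move: nU; rewrite E leqNgt iN.
  have L1i k : L1 (\1_(U @^-1` [set k])).
    by apply: L1_bounded (measurable_indic _) _ => // om;
      rewrite indicE; case: (_ \in _); rewrite ?normr1 ?normr0.
  rewrite Ex_sum; last by move=> k; exact/L1Z/L1i.
  rewrite /series/=; apply: eq_bigr => k _; rewrite ExZ//; congr (_ * _).
  by rewrite /Rintegral integral_indic// setIT.
rewrite -(_ : (fun n => Ex (g n)) = series _); last by apply/funext => n; rewrite gE.
have mg n : measurable_fun setT (g n).
  exact: (measurable_discrete (fun k => h k * (k < n)%N%:R)).
have := @dominated_convergence _ Omega R Pr setT measurableT
  (fun n om => (g n om)%:E) (fun om => (h (U om))%:E) (fun om => `|h (U om)|%:E).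
case.
- by move=> n; apply/measurable_EFinP; exact: mg.
- exact: measurable_int Lh.
- apply: aeW => om _; apply: cvg_near_cst; exists (U om).+1 => // n /= Un.
  by rewrite /g Un mulr1.
- exact: L1_abs.
- apply: aeW => om n _; rewrite lee_fin /g.
  by case: (_ < _)%N; rewrite ?mulr1// mulr0 normr0.
move=> _ _; rewrite -Ex_EFin// => H.
have : fine \o (fun n => \int[Pr]_om (g n om)%:E)%E @ \oo --> Ex (fun om => h (U om)).
  exact: fine_cvg.
by [].
Qed.

End discrete.

Section independence2.
Variables U V : Omega -> nat.
Hypothesis mU : forall A, measurable (U @^-1` A).
Hypothesis mV : forall A, measurable (V @^-1` A).
Hypothesis UV : forall u v, (Pr (U @^-1` [set u] `&` V @^-1` [set v]) =
  Pr (U @^-1` [set u]) * Pr (V @^-1` [set v]))%E.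

(** Split over the fibers of [U], then of [V]: independence on pairs of singletons factors each
    term. Integrability of [g] keeps the factor pulled out of the series finite. *)
Lemma ge0_integral_indep (f g : nat -> R) :
  (forall n, 0 <= f n) -> (forall n, 0 <= g n) ->
  L1 (fun om => g (V om)) ->
  (\int[Pr]_om (f (U om) * g (V om))%:E =
   (\int[Pr]_om (f (U om))%:E) * \int[Pr]_om (g (V om))%:E)%E.
Proof.
move=> f0 g0 Lg.
have mUT : (\bigcup_n (U @^-1` [set n])) = setT.
  by apply/seteqP; split=> // om _; exists (U om).
have -> : (\int[Pr]_om (f (U om) * g (V om))%:E =
    \sum_(0 <= u <oo) \int[Pr]_(om in U @^-1` [set u]) (f (U om) * g (V om))%:E)%E.
  rewrite -[in LHS]mUT ge0_integral_bigcup//.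
  - rewrite mUT; apply/measurable_EFinP; apply: measurable_funM.
      exact: measurable_discrete.
    exact: measurable_discrete.
  - by move=> om _; rewrite lee_fin mulr_ge0.
  - by move=> i j _ _ [om [/= <- <-]].
have f0E n : (0 <= (f n)%:E)%E by rewrite lee_fin.
have g0E n : (0 <= (g n)%:E)%E by rewrite lee_fin.
rewrite (ge0_integral_discrete mU measurableT f0E).
rewrite muleC.
set G := (\int[Pr]_om (g (V om))%:E)%E.
have Gfin : G \is a fin_num by exact: integrable_fin_num.
have inner u : (\int[Pr]_(om in U @^-1` [set u]) (f (U om) * g (V om))%:E =
    (f u)%:E * Pr (U @^-1` [set u]) * G)%E.
  under eq_integral.
    move=> om; rewrite inE/= => ->; rewrite EFinM; over.
  rewrite ge0_integralZl//; last first.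
    by apply/measurable_EFinP/measurable_funTS; exact: measurable_discrete.
  rewrite -muleA; congr (_ * _)%E.
  rewrite (ge0_integral_discrete mV (mU _) g0E).
  rewrite /G (ge0_integral_discrete mV measurableT g0E).
  rewrite -[Pr (U @^-1` _)]fineK ?fin_num_measure// -nneseriesZl//; last first.
    by move=> n _; rewrite mule_ge0// lee_fin.
  apply: eq_eseriesr => n _; rewrite UV setTI fineK ?fin_num_measure//.
  by rewrite muleCA.
under eq_eseriesr do rewrite inner.
under [in RHS]eq_eseriesr do rewrite setTI.
have h0 n : (0 <= (f n)%:E * Pr (U @^-1` [set n]))%E by rewrite mule_ge0// lee_fin.
rewrite -[G]fineK// -nneseriesZl//; apply: eq_eseriesr => n _.
by rewrite fineK// muleC.
Qed.

Lemma L1_indep (f g : nat -> R) :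
  L1 (fun om => f (U om)) -> L1 (fun om => g (V om)) ->
  L1 (fun om => f (U om) * g (V om)).
Proof.
move=> Lf Lg; apply/integrableP; split.
  apply/measurable_EFinP; apply: measurable_funM; exact: measurable_discrete.
under eq_integral do rewrite /= normrM.
rewrite (@ge0_integral_indep (fun n => `|f n|) (fun n => `|g n|))//; last exact: L1_abs.
by rewrite -!Ex_EFin ?ltry//; exact: L1_abs.
Qed.

(** Positive and negative parts reduce to the nonnegative case, for [g] in [key2] and then for
    [f]. *)
Lemma Ex_indep (f g : nat -> R) :
  L1 (fun om => f (U om)) -> L1 (fun om => g (V om)) ->
  Ex (fun om => f (U om) * g (V om)) =
  Ex (fun om => f (U om)) * Ex (fun om => g (V om)).
Proof.
have pos (h : nat -> R) : (forall n, 0 <= Num.max (h n) 0 :> R).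
  by move=> n; rewrite le_max lexx orbT.
have neg (h : nat -> R) : (forall n, 0 <= Num.max (- h n) 0 :> R).
  by move=> n; rewrite le_max lexx orbT.
have posneg (h : nat -> R) n : h n = Num.max (h n) 0 - Num.max (- h n) 0 :> R.
  by rewrite /Num.max; case: ltP => ?; case: ltP => ?; lra.
have Lpos (W : Omega -> nat) (mW : forall A, measurable (W @^-1` A)) (h : nat -> R) :
    L1 (fun om => h (W om)) ->
    L1 (fun om => Num.max (h (W om)) 0) /\ L1 (fun om => Num.max (- h (W om)) 0).
  move=> Lh; split; apply: L1_le (Lh) _.
  - exact: (@measurable_discrete W mW _ _ (fun n => Num.max (h n) 0)).
  - by move=> om; rewrite /Num.max; case: ltP; rewrite ?normr0//.
  - exact: (@measurable_discrete W mW _ _ (fun n => Num.max (- h n) 0)).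
  - by move=> om; rewrite /Num.max; case: ltP; rewrite ?normr0// normrN.
have key (h k : nat -> R) : (forall n, 0 <= h n) -> (forall n, 0 <= k n) ->
    L1 (fun om => h (U om)) -> L1 (fun om => k (V om)) ->
    Ex (fun om => h (U om) * k (V om)) =
    Ex (fun om => h (U om)) * Ex (fun om => k (V om)).
  move=> h0 k0 Lh Lk; rewrite {1}/Rintegral ge0_integral_indep//.
  by rewrite fineM//; exact: integrable_fin_num.
have key2 (h k : nat -> R) : (forall n, 0 <= h n) ->
    L1 (fun om => h (U om)) -> L1 (fun om => k (V om)) ->
    Ex (fun om => h (U om) * k (V om)) =
    Ex (fun om => h (U om)) * Ex (fun om => k (V om)).
  move=> h0 Lh Lk; have [Lp Ln] := Lpos V mV k Lk.
  under eq_Rintegral do rewrite (posneg k) mulrBr.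
  under [X in _ = _ * X]eq_Rintegral do rewrite (posneg k).
  rewrite !ExB//; last 2 first.
  - exact: (@L1_indep h (fun n => Num.max (k n) 0)).
  - exact: (@L1_indep h (fun n => Num.max (- k n) 0)).
  rewrite mulrBr (key h (fun n => Num.max (k n) 0))//.
  by rewrite (key h (fun n => Num.max (- k n) 0)).
move=> Lf Lg; have [Lp Ln] := Lpos U mU f Lf.
under eq_Rintegral do rewrite (posneg f) mulrBl.
under [X in _ = X * _]eq_Rintegral do rewrite (posneg f).
rewrite !ExB//; last 2 first.
- exact: (@L1_indep (fun n => Num.max (f n) 0) g).
- exact: (@L1_indep (fun n => Num.max (- f n) 0) g).
rewrite mulrBl (key2 (fun n => Num.max (f n) 0))//.
by rewrite (key2 (fun n => Num.max (- f n) 0)).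
Qed.

End independence2.
End expectation_real.

(** * Moments of sums of independent samples *)

Section iid.
Context {R : realType} {dO : measure_display} {Omega : measurableType dO}.
Variables (Pr : probability Omega R) (Zs : nat -> Omega -> nat) (p : nat -> R).
Hypothesis Zs_meas : forall m (A : set nat), measurable (Zs m @^-1` A).
Hypothesis Zs_law : forall m z, Pr (Zs m @^-1` [set z]) = (p z)%:E.
Hypothesis Zs_indep : mutually_independent Pr Zs.

Local Notation L1 := (L1 Pr).
Local Notation "'Ex' X" := (Rintegral Pr setT X) (at level 10, X at level 8).

(** A statistic of finitely many samples is written as a function of the list of their values. There
    are countably many lists, so any such function is measurable. *)
Definition tup (s : seq nat) (om : Omega) : seq nat := [seq Zs j om | j <- s].

Lemma measurable_preimage_tup s (A : set (seq nat)) : measurable (tup s @^-1` A).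
Proof.
elim: s A => [|j s IH] A.
  have [A0|A0] := pselect (A [::]).
    by rewrite (_ : _ @^-1` _ = setT)//; apply/seteqP; split.
  by rewrite (_ : _ @^-1` _ = set0)//; apply/seteqP; split.
rewrite (_ : _ @^-1` _ =
  \bigcup_x (Zs j @^-1` [set x] `&` tup s @^-1` [set t | A (x :: t)])).
  by apply: bigcup_measurable => x _; exact: measurableI.
apply/seteqP; split=> [om /= Aom|om [x _ [/= <-]]//].
by exists (Zs j om).
Qed.

Lemma measurable_tup d' (T' : measurableType d') (F : seq nat -> T') s :
  measurable_fun setT (fun om => F (tup s om)).
Proof.
move=> _ B mB; rewrite setTI.
exact: (measurable_preimage_tup s (F @^-1` B)).
Qed.

Lemma measurable_Zs d' (T' : measurableType d') (f : nat -> T') m :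
  measurable_fun setT (fun om => f (Zs m om)).
Proof. exact: measurable_discrete. Qed.

Lemma preimage_tup1 s t : uniq s -> size t = size s ->
  tup s @^-1` [set t] =
  \bigcap_(j in [set` s]) Zs j @^-1` [set nth 0%N t (index j s)].
Proof.
move=> us st; apply/seteqP; split=> [om /= <- j /= js|om /= H].
  by rewrite (nth_map 0%N) ?index_mem// nth_index.
apply: (@eq_from_nth _ 0%N); first by rewrite size_map.
move=> i; rewrite size_map => si; rewrite (nth_map 0%N)//.
by rewrite (H (nth 0%N s i)) /=; [rewrite index_uniq|exact: mem_nth].
Qed.

Lemma tup_indep m s u t : uniq (m :: s) ->
  (Pr (Zs m @^-1` [set u] `&` tup s @^-1` [set t]) =
   Pr (Zs m @^-1` [set u]) * Pr (tup s @^-1` [set t]))%E.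
Proof.
move=> /= /andP[ms us].
have [st|st] := eqVneq (size t) (size s); last first.
  have -> : tup s @^-1` [set t] = set0.
    by apply/seteqP; split=> // om /= E; move: st; rewrite -E size_map eqxx.
  by rewrite setI0 measure0 mule0.
rewrite preimage_tup1//.
(* The two events are glued into a single family indexed by [m :: s], the shape in which mutual
   independence is given; this is consistent because [m] is not in [s]. *)
pose A j := if j == m then [set u] else [set nth 0%N t (index j s)].
have As j : j \in s -> A j = [set nth 0%N t (index j s)].
  by rewrite /A; case: eqP => // -> js; rewrite js in ms.
have -> : \bigcap_(j in [set` s]) Zs j @^-1` [set nth 0%N t (index j s)] =
    \bigcap_(j in [set` s]) Zs j @^-1` A j.
  by apply: eq_bigcapr => j /= js; rewrite As.
have -> : [set u] = A m by rewrite /A eqxx.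
have -> : Zs m @^-1` A m `&` \bigcap_(j in [set` s]) Zs j @^-1` A j =
    \bigcap_(j in [set` m :: s]) Zs j @^-1` A j.
  apply/seteqP; split=> [om [Am As'] j /=|om H].
    by rewrite inE => /orP[/eqP ->//|js]; exact: As'.
  split; first by apply: H; rewrite /= mem_head.
  by move=> j js; apply: H; rewrite /= inE js orbT.
rewrite Zs_indep/= ?ms//.
by rewrite big_cons Zs_indep.
Qed.

Section pairing.
Variables (m : nat) (s : seq nat).
Hypothesis ms : uniq (m :: s).
Variables (f : nat -> R) (F : seq nat -> R).
Hypothesis Lf : L1 (fun om => f (Zs m om)).
Hypothesis LF : L1 (fun om => F (tup s om)).

(** The list is coded by a natural number, so that the results on two nat-valued variables apply.
    The value 0 in [g] concerns numbers that code no list, which [V] never takes. *)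
Let V om := pickle (tup s om).
Let g n := oapp F 0 (unpickle n).

Let gV om : g (V om) = F (tup s om).
Proof. by rewrite /g /V pickleK. Qed.

Let mV A : measurable (V @^-1` A).
Proof. exact: (measurable_preimage_tup s (pickle @^-1` A)). Qed.

Let UV u v : (Pr (Zs m @^-1` [set u] `&` V @^-1` [set v]) =
  Pr (Zs m @^-1` [set u]) * Pr (V @^-1` [set v]))%E.
Proof.
have [[t tv]|nt] := pselect (exists t : seq nat, pickle t = v).
  have -> : V @^-1` [set v] = tup s @^-1` [set t].
    apply/seteqP; split=> om /=; last by rewrite /V => ->.
    by rewrite -tv => /(pcan_inj pickleK).
  exact: tup_indep.
have -> : V @^-1` [set v] = set0.
  by apply/seteqP; split=> // om /= E; apply: nt; exists (tup s om).
by rewrite setI0 measure0 mule0.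
Qed.

Let FE : (fun om => F (tup s om)) = (fun om => g (V om)).
Proof. by apply/funext => om; rewrite gV. Qed.

Let fFE : (fun om => f (Zs m om) * F (tup s om)) =
  (fun om => f (Zs m om) * g (V om)).
Proof. by apply/funext => om; rewrite gV. Qed.

Lemma L1_indep_tup : L1 (fun om => f (Zs m om) * F (tup s om)).
Proof.
by rewrite fFE; apply: (@L1_indep _ _ _ Pr _ _ (Zs_meas m) mV UV f g) => //;
  rewrite -FE.
Qed.

Lemma Ex_indep_tup : Ex (fun om => f (Zs m om) * F (tup s om)) =
  Ex (fun om => f (Zs m om)) * Ex (fun om => F (tup s om)).
Proof.
by rewrite fFE FE; apply: (@Ex_indep _ _ _ Pr _ _ (Zs_meas m) mV UV f g) => //;
  rewrite -FE.
Qed.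

End pairing.

(** The integral of the absolute value is a series that depends only on the common law. *)
Lemma L1_iid (f : nat -> R) m n : L1 (fun om => f (Zs m om)) ->
  L1 (fun om => f (Zs n om)).
Proof.
move=> /integrableP[_ fy]; apply/integrableP; split.
  exact/measurable_EFinP/measurable_Zs.
have f0 k : (0 <= `|(f k)%:E|)%E by [].
move: fy.
rewrite /= (ge0_integral_discrete Pr (Zs_meas m) measurableT f0).
rewrite (ge0_integral_discrete Pr (Zs_meas n) measurableT f0).
rewrite (@eq_eseriesr _ _
  (fun k => `|(f k)%:E| * Pr ([set: Omega] `&` Zs n @^-1` [set k]))%E)// => k _.
by rewrite !setTI !Zs_law.
Qed.

Lemma Ex_law (f : nat -> R) m : L1 (fun om => f (Zs m om)) ->
  series (fun z => f z * p z) @ \oo --> Ex (fun om => f (Zs m om)).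
Proof.
move=> Lf; have := Ex_discrete_series (Zs_meas m) Lf.
by rewrite (_ : (fun n => f n * fine _) = (fun z => f z * p z))//;
  apply/funext => z; rewrite Zs_law.
Qed.

Lemma Ex_iid (f : nat -> R) m n : L1 (fun om => f (Zs m om)) ->
  Ex (fun om => f (Zs m om)) = Ex (fun om => f (Zs n om)).
Proof.
move=> Lf; rewrite -(cvg_lim _ (Ex_law Lf))//.
by rewrite -(cvg_lim _ (Ex_law (L1_iid n Lf))).
Qed.

Lemma L1_sqr (f : nat -> R) m : L1 (fun om => f (Zs m om) ^+ 2) ->
  L1 (fun om => f (Zs m om)).
Proof.
move=> Lf; apply: L1_le (measurable_Zs _ _) (L1D (L1_cst Pr 1) Lf) _ => om.
rewrite [leRHS]ger0_norm; last by rewrite addr_ge0// sqr_ge0.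
by rewrite -real_normK ?num_real//; nra.
Qed.

Definition tsum (v : nat -> R) (s : seq nat) (om : Omega) :=
  \sum_(j <- s) v (Zs j om).

Lemma tsumE v s om : tsum v s om = \sum_(x <- tup s om) v x.
Proof. by rewrite /tsum /tup big_map. Qed.

Lemma measurable_tsum v s : measurable_fun setT (tsum v s).
Proof.
rewrite (_ : tsum v s = fun om => \sum_(x <- tup s om) v x).
  exact: (measurable_tup (fun t : seq nat => \sum_(x <- t) v x)).
by apply/funext => om; rewrite tsumE.
Qed.

Section second_moment.
Variable v : nat -> R.
Hypothesis Lv2 : L1 (fun om => v (Zs 0%N om) ^+ 2).
Hypothesis Ev : Ex (fun om => v (Zs 0%N om)) = 0.

Lemma L1_tsum s : L1 (tsum v s).
Proof. by apply: L1_sum => i; apply/(@L1_iid v 0%N)/L1_sqr. Qed.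

Lemma Ex_tsum s : Ex (tsum v s) = 0.
Proof.
rewrite Ex_sum; last by move=> i; apply/(@L1_iid v 0%N)/L1_sqr.
by rewrite big1// => i _; rewrite (@Ex_iid v _ 0%N)//; apply/(@L1_iid v 0%N)/L1_sqr.
Qed.

(** The cross term has mean zero, by independence and centering. Only square integrability of [v] is
    asked, since the strong law applies it to unbounded gradient samples. *)
Lemma tsum_sqr s : uniq s -> L1 (fun om => tsum v s om ^+ 2) /\
  Ex (fun om => tsum v s om ^+ 2) =
  (size s)%:R * Ex (fun om => v (Zs 0%N om) ^+ 2).
Proof.
elim: s => [_|m s IH us].
  have -> : (fun om => tsum v [::] om ^+ 2) = (fun=> 0).
    by apply/funext => om; rewrite /tsum big_nil expr0n.
  by rewrite mul0r Ex_cst; split => //; exact: L1_cst.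
have [L IHs] := IH (andP us).2.
have L1m : L1 (fun om => v (Zs m om)) by apply/(@L1_iid v 0%N)/L1_sqr.
have L2m : L1 (fun om => v (Zs m om) ^+ 2) by exact/(@L1_iid (fun z => v z ^+ 2) 0%N).
have Lp : L1 (fun om => v (Zs m om) * tsum v s om).
  under eq_fun do rewrite tsumE.
  apply: (L1_indep_tup us (F := fun t => \sum_(x <- t) v x)) => //.
  by under eq_fun do rewrite -tsumE; exact: L1_tsum.
have Ep : Ex (fun om => v (Zs m om) * tsum v s om) = 0.
  under eq_Rintegral do rewrite tsumE.
  rewrite (Ex_indep_tup us (F := fun t => \sum_(x <- t) v x))//.
    by rewrite (@Ex_iid v m 0%N)// Ev mul0r.
  by under eq_fun do rewrite -tsumE; exact: L1_tsum.
have -> : (fun om => tsum v (m :: s) om ^+ 2) = (fun om => v (Zs m om) ^+ 2 +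
    (2 * (v (Zs m om) * tsum v s om) + tsum v s om ^+ 2)).
  by apply/funext => om; rewrite /tsum big_cons; ring.
split; first by do 2 (apply: L1D => //); exact: L1Z.
rewrite ExD//; last by apply: L1D => //; exact: L1Z.
rewrite ExD//; last exact: L1Z.
rewrite ExZ// Ep mulr0 add0r IHs (@Ex_iid (fun z => v z ^+ 2) m 0%N)//=.
by rewrite mulrSr addrC mulrDl mul1r.
Qed.

End second_moment.

Section fourth_moment.
Variable v : nat -> R.
Hypothesis v1 : forall z, `|v z| <= 1.
Hypothesis Ev : Ex (fun om => v (Zs 0%N om)) = 0.

Lemma L1_boundedZs (h : nat -> R) m : (forall z, `|h z| <= 1) ->
  L1 (fun om => h (Zs m om)).
Proof.
by move=> h1; exact: L1_bounded (measurable_Zs _ _) (fun om => h1 (Zs m om)).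
Qed.

Lemma normrX_le1 (x : R) n : `|x| <= 1 -> `|x ^+ n| <= 1.
Proof. by move=> x1; rewrite normrX exprn_ile1. Qed.

Lemma L1_tsumX s n : L1 (fun om => tsum v s om ^+ n).
Proof.
apply: (@L1_bounded _ _ _ _ _ ((size s)%:R ^+ n)).
  by apply: measurable_funX; exact: measurable_tsum.
move=> om; rewrite normrX lerXn2r ?nnegrE//.
rewrite /tsum (le_trans (ler_norm_sum _ _ _))//.
by rewrite -sum1_size natr_sum; exact: ler_sum.
Qed.

Lemma L1_bounded_tsumX m s a b : uniq (m :: s) ->
  L1 (fun om => v (Zs m om) ^+ a * tsum v s om ^+ b).
Proof.
move=> us; under eq_fun do rewrite tsumE.
apply: (L1_indep_tup us (f := fun z => v z ^+ a)
  (F := fun t => (\sum_(x <- t) v x) ^+ b)).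
  by apply: (@L1_boundedZs (fun z => v z ^+ a)) => z; exact: normrX_le1.
by under eq_fun do rewrite -tsumE; exact: L1_tsumX.
Qed.

Lemma Ex_tsumX m s a b : uniq (m :: s) ->
  Ex (fun om => v (Zs m om) ^+ a * tsum v s om ^+ b) =
  Ex (fun om => v (Zs 0%N om) ^+ a) * Ex (fun om => tsum v s om ^+ b).
Proof.
move=> us; under eq_Rintegral do rewrite tsumE.
have Lv : L1 (fun om => v (Zs m om) ^+ a).
  by apply: (@L1_boundedZs (fun z => v z ^+ a)) => z; exact: normrX_le1.
rewrite (Ex_indep_tup us (f := fun z => v z ^+ a)
  (F := fun t => (\sum_(x <- t) v x) ^+ b))//.
  rewrite (@Ex_iid (fun z => v z ^+ a) m 0%N)//; congr (_ * _).
  by under eq_Rintegral do rewrite -tsumE.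
by under eq_fun do rewrite -tsumE; exact: L1_tsumX.
Qed.

Let Lv2 : L1 (fun om => v (Zs 0%N om) ^+ 2).
Proof. by apply: (@L1_boundedZs (fun z => v z ^+ 2)) => z; exact: normrX_le1. Qed.

Let moment_le1 n : `|Ex (fun om => v (Zs 0%N om) ^+ n)| <= 1.
Proof.
rewrite -[leRHS](Ex_cst Pr); apply: Ex_abs_le.
- by apply: (@L1_boundedZs (fun z => v z ^+ n)) => z; exact: normrX_le1.
- exact: L1_cst.
- by move=> om; exact: normrX_le1.
Qed.

Let moment0 : Ex (fun om => v (Zs 0%N om) ^+ 0) = 1.
Proof. exact: Ex_cst. Qed.

Let moment1 : Ex (fun om => v (Zs 0%N om) ^+ 1) = 0.
Proof. exact: Ev. Qed.

Let tsum0 s : Ex (fun om => tsum v s om ^+ 0) = 1.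
Proof. exact: Ex_cst. Qed.

Let tsum1 s : Ex (fun om => tsum v s om ^+ 1) = 0.
Proof. exact: (Ex_tsum Lv2 Ev). Qed.

(** In the cube of a sum of two independent centered variables both mixed terms have mean zero, so
    third moments add. *)
Lemma tsum_cube s : uniq s -> Ex (fun om => tsum v s om ^+ 3) =
  (size s)%:R * Ex (fun om => v (Zs 0%N om) ^+ 3).
Proof.
elim: s => [_|m s IH us].
  rewrite mul0r -[RHS](Ex_cst Pr).
  rewrite (_ : (fun om => tsum v [::] om ^+ 3) = (fun=> 0))//.
  by apply/funext => om; rewrite /tsum big_nil expr0n.
have IHs := IH (andP us).2.
(* Exponents 0 and 1 stay explicit so that every summand has the form handled by [Ex_tsumX]. *)
have -> : (fun om => tsum v (m :: s) om ^+ 3) = (fun om =>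
    v (Zs m om) ^+ 3 * tsum v s om ^+ 0 +
    (3 * (v (Zs m om) ^+ 2 * tsum v s om ^+ 1) +
    (3 * (v (Zs m om) ^+ 1 * tsum v s om ^+ 2) +
    v (Zs m om) ^+ 0 * tsum v s om ^+ 3))).
  by apply/funext => om; rewrite /tsum big_cons; ring.
have LL a b := L1_bounded_tsumX a b us.
have LZ c a b := L1Z c (LL a b).
do 3 (rewrite ExD; [|by []|by do ?[exact: LL|exact: LZ|apply: L1D]]).
rewrite !(ExZ 3)// !Ex_tsumX// !moment0 moment1 ?tsum0 tsum1 IHs /= -natr1; ring.
Qed.

(** Of the mixed terms only the one of type (2,2) survives, with coefficient 6. As moments of [v]
    are at most 1, the step reads 3n^2 + 6n + 1 <= 3(n+1)^2. *)
Lemma tsum_fourth s : uniq s -> Ex (fun om => tsum v s om ^+ 4) <=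
  3 * (size s)%:R ^+ 2.
Proof.
elim: s => [_|m s IH us].
  rewrite expr0n/= mulr0 -[leRHS](Ex_cst Pr).
  rewrite (_ : (fun om => tsum v [::] om ^+ 4) = (fun=> 0))//.
  by apply/funext => om; rewrite /tsum big_nil expr0n.
have IHs := IH (andP us).2.
have -> : (fun om => tsum v (m :: s) om ^+ 4) = (fun om =>
    v (Zs m om) ^+ 4 * tsum v s om ^+ 0 +
    (4 * (v (Zs m om) ^+ 3 * tsum v s om ^+ 1) +
    (6 * (v (Zs m om) ^+ 2 * tsum v s om ^+ 2) +
    (4 * (v (Zs m om) ^+ 1 * tsum v s om ^+ 3) +
    v (Zs m om) ^+ 0 * tsum v s om ^+ 4)))).
  by apply/funext => om; rewrite /tsum big_cons; ring.
have LL a b := L1_bounded_tsumX a b us.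
have LZ c a b := L1Z c (LL a b).
do 4 (rewrite ExD; [|by []|by do ?[exact: LL|exact: LZ|apply: L1D]]).
  rewrite !(ExZ 4)// !(ExZ 6)// !Ex_tsumX// !moment0 moment1 ?tsum0 tsum1.
  rewrite (tsum_sqr Lv2 Ev (andP us).2).2 /=.
  have := moment_le1 4; rewrite ler_norml => /andP[_].
  have := moment_le1 2; rewrite ler_norml => /andP[_].
  have := @Ex_ge0 _ _ _ Pr (fun om => v (Zs 0%N om) ^+ 2) (fun om => sqr_ge0 _).
  have : 0 <= (size s)%:R :> R by [].
  move: IHs; set S4 := Rintegral Pr _ (fun om => tsum v s om ^+ 4).
  set m2 := Rintegral Pr _ (fun om => v (Zs 0%N om) ^+ 2).
  set m4 := Rintegral Pr _ (fun om => v (Zs 0%N om) ^+ 4).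
  set n := (size s)%:R => H n0 m20 m21 m41.
  have m22 : m2 * m2 <= 1 by nra.
  have nm : n * (m2 * m2) <= n by rewrite ler_piMr.
  rewrite !mulr0 !mul0r !mulr0 !add0r.
  rewrite -(natr1 (size s)) -/n; nra.
Qed.

End fourth_moment.
End iid.

(** * Strong law of large numbers for square-integrable variables *)

Section strong_law.
Context {R : realType} {dO : measure_display} {Omega : measurableType dO}.
Variable Pr : probability Omega R.

Local Notation L1 := (L1 Pr).
Local Notation "'Ex' X" := (Rintegral Pr setT X) (at level 10, X at level 8).

(** The integral of the sum of the series is at most [B], so the series converges almost surely and
    its terms tend to 0. *)
Lemma summable_Ex_cvg0 (W : nat -> Omega -> R) (B : R) :
  (forall n om, 0 <= W n om) -> (forall n, L1 (W n)) ->
  (forall N, \sum_(0 <= n < N) Ex (W n) <= B) ->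
  {ae Pr, forall om, W ^~ om @ \oo --> 0}.
Proof.
move=> W0 LW WB.
have mW n : measurable_fun setT (fun om => (W n om)%:E).
  exact/measurable_EFinP/L1_measurable/LW.
have W0E n om : (0 <= (W n om)%:E)%E by rewrite lee_fin.
have IF : (\int[Pr]_om (\sum_(0 <= n <oo) (W n om)%:E) <= B%:E)%E.
  rewrite integral_nneseries//; apply: lime_le.
    by apply: is_cvg_nneseries => n _ _; exact: integral_ge0.
  apply: nearW => N.
  under eq_bigr do rewrite -Ex_EFin//.
  by rewrite sumEFin lee_fin.
have F0 om : (0 <= \sum_(0 <= n <oo) (W n om)%:E)%E by exact: nneseries_ge0.
have iF : Pr.-integrable setT (fun om => \sum_(0 <= n <oo) (W n om)%:E)%E.
  apply/integrableP; split; first exact: ge0_emeasurable_sum.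
  under eq_integral do rewrite gee0_abs//.
  exact: le_lt_trans IF (ltry _).
apply: filterS (integrable_ae measurableT iF) => om /(_ I) Ffin.
apply: cvg_series_cvg_0; apply: nnseries_is_cvg => //.
by rewrite ltey_eq Ffin.
Qed.

(** Telescoping: the new term 1/(M+2)^2 is at most 1/(M+1) - 1/(M+2), which the sharper bound 2 -
    1/(M+1) absorbs. *)
Lemma sum_inv_sqr_le2 N : \sum_(0 <= n < N) (n.+1%:R ^- 2) <= 2 :> R.
Proof.
have H M : \sum_(0 <= n < M.+1) (n.+1%:R ^- 2) <= 2 - M.+1%:R^-1 :> R.
  elim: M => [|M IH]; first by rewrite big_nat1 expr1n invr1; lra.
  rewrite big_nat_recr//=; apply: le_trans (lerD IH (lexx _)) _.
  have M0 : 0 < M.+1%:R :> R by rewrite ltr0n.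
  have M1 : 0 < M.+2%:R :> R by rewrite ltr0n.
  have E : M.+1%:R^-1 - M.+2%:R^-1 = M.+1%:R^-1 * M.+2%:R^-1 :> R.
    move: M0 M1; rewrite -(natr1 M.+1); move: M.+1%:R => x x0 x1.
    by field; rewrite !lt0r_neq0.
  have : M.+2%:R ^- 2 <= M.+1%:R^-1 * M.+2%:R^-1 :> R.
    by rewrite -exprVn expr2 ler_wpM2r ?invr_ge0 ?(ltW M1)// lef_pV2 ?posrE// ler_nat.
  rewrite -E; move: M.+1%:R^-1 M.+2%:R^-1 (_ ^- 2) => a b c; lra.
case: N => [|N]; first by rewrite big_geq.
by apply: le_trans (H N) _; rewrite gerBl.
Qed.

Lemma sqrt_bracket N : (0 < N)%N ->
  exists2 n, (n.+1 ^ 2 <= N)%N & (N < n.+2 ^ 2)%N.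
Proof.
elim: N => // -[_ _|N /(_ isT)[n nN Nn] _]; first by exists 0%N.
have [NE|NE] := ltnP N.+2 (n.+2 ^ 2); first by exists n => //; exact: leqW.
exists n.+1 => //; apply: leq_ltn_trans Nn _.
by rewrite ltn_exp2r.
Qed.

Variables (Zs : nat -> Omega -> nat) (p : nat -> R).
Hypothesis Zs_meas : forall m (A : set nat), measurable (Zs m @^-1` A).
Hypothesis Zs_law : forall m z, Pr (Zs m @^-1` [set z]) = (p z)%:E.
Hypothesis Zs_indep : mutually_independent Pr Zs.

(* Rajchman's argument: the squared partial sums along the squares, together with
   the fluctuations between consecutive squares, have summable expectations. *)
Lemma slln_centered (v : nat -> R) :
  L1 (fun om => v (Zs 0%N om) ^+ 2) -> Ex (fun om => v (Zs 0%N om)) = 0 ->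
  {ae Pr, forall om,
    (fun N => (N%:R)^-1 * \sum_(m < N) v (Zs m om)) @ \oo --> 0}.
Proof.
move=> Lv2 Ev; set sg := Ex (fun om => v (Zs 0%N om) ^+ 2).
have sg0 : 0 <= sg by apply: Ex_ge0 => om; exact: sqr_ge0.
have TS a k : L1 (fun om => tsum Zs v (iota a k) om ^+ 2) /\
    Ex (fun om => tsum Zs v (iota a k) om ^+ 2) = k%:R * sg.
  have := @tsum_sqr _ _ _ Pr Zs p Zs_meas Zs_law Zs_indep v Lv2 Ev
    (iota a k) (iota_uniq _ _).
  by rewrite size_iota.
(* For N in [(n+1)^2, (n+2)^2) the excess N - (n+1)^2 is less than 2n+3, so the sum over [k]
   dominates whichever tail occurs; the prefactor dominates 1/N^2. *)
pose W n om := n.+1%:R ^- 4 * (tsum Zs v (iota 0 (n.+1 ^ 2)) om ^+ 2 +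
  \sum_(k <- iota 0 (2 * n + 3)) tsum Zs v (iota (n.+1 ^ 2) k) om ^+ 2).
have LS n : L1 (fun om =>
    \sum_(k <- iota 0 (2 * n + 3)) tsum Zs v (iota (n.+1 ^ 2) k) om ^+ 2).
  by apply: L1_sum => k; exact: (TS _ _).1.
have LW n : L1 (W n) by apply/L1Z/L1D => //; exact: (TS _ _).1.
have W0 n om : 0 <= W n om.
  rewrite mulr_ge0 ?invr_ge0 ?exprn_ge0// addr_ge0 ?sqr_ge0//.
  by apply: sumr_ge0 => k _; exact: sqr_ge0.
(* 10 = 1 + 9: the sum up to the square contributes (n+1)^2 [sg], the 2n+3 tails at most (3(n+1))^2
   [sg]. *)
have EW n : Ex (W n) <= n.+1%:R ^- 2 * (10 * sg).
  rewrite ExZ; last by apply/L1D => //; exact: (TS _ _).1.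
  rewrite ExD//; last exact: (TS _ _).1.
  rewrite (TS _ _).2 Ex_sum; last by move=> k; exact: (TS _ _).1.
  have -> : \sum_(i <- iota 0 (2 * n + 3))
        Ex (fun om => tsum Zs v (iota (n.+1 ^ 2) i) om ^+ 2)
      = \sum_(i <- iota 0 (2 * n + 3)) i%:R * sg.
    by apply: eq_bigr => k _; rewrite (TS _ _).2.
  have HS : \sum_(i <- iota 0 (2 * n + 3)) i%:R * sg <= (3 * n.+1%:R) ^+ 2 * sg.
    apply: (@le_trans _ _ (\sum_(i <- iota 0 (2 * n + 3)) (3 * n.+1%:R) * sg)).
      rewrite big_seq [leRHS]big_seq; apply: ler_sum => i.
      rewrite mem_iota => /andP[_ iN].
      by rewrite ler_wpM2r// -natrM ler_nat; lia.
    rewrite big_const_seq count_predT size_iota iter_addr addr0.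
    rewrite -[leLHS]mulr_natl mulrA.
    by rewrite ler_wpM2r// expr2 ler_wpM2r ?mulr_ge0// -natrM ler_nat; lia.
  have n0 : 0 < n.+1%:R :> R by rewrite ltr0n.
  have -> : n.+1%:R ^- 2 * (10 * sg) =
      n.+1%:R ^- 4 * (n.+1%:R ^+ 2 * sg + (3 * n.+1%:R) ^+ 2 * sg).
    by move: n.+1%:R n0 => x x0; field; rewrite lt0r_neq0.
  rewrite ler_wpM2l ?invr_ge0 ?exprn_ge0//.
  by rewrite natrX lerD2l.
have WB N : \sum_(0 <= n < N) Ex (W n) <= 2 * (10 * sg).
  apply: (@le_trans _ _ (\sum_(0 <= n < N) n.+1%:R ^- 2 * (10 * sg))).
    by apply: ler_sum => n _; exact: EW.
  by rewrite -mulr_suml ler_wpM2r ?mulr_ge0// sum_inv_sqr_le2.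
apply: filterS (summable_Ex_cvg0 W0 LW WB) => om W_0.
apply/cvgrPdist_le => e e0.
(* The squared mean will be bounded by [2 * W n om], because (A + B)^2 <= 2 (A^2 + B^2). *)
have e2 : 0 < e ^+ 2 / 2 by rewrite divr_gt0// exprn_gt0.
move/cvgrPdist_le : W_0 => /(_ _ e2)[n0 _ Wn0].
exists (n0.+1 ^ 2)%N => // N /= n0N.
have [|n nN Nn] := @sqrt_bracket N; first by apply: leq_trans n0N; rewrite expn_gt0.
have nn0 : (n0 <= n)%N.
  by have := leq_ltn_trans n0N Nn; rewrite ltn_exp2r// !ltnS.
have := Wn0 n nn0; rewrite !sub0r !normrN => Wn.
rewrite -(@ler_pXn2r _ 2)// ?nnegrE// ?(ltW e0)//.
rewrite real_normK ?num_real//.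
suff : (N%:R^-1 * \sum_(m < N) v (Zs m om)) ^+ 2 <= 2 * W n om.
  by move: Wn; rewrite ger0_norm//; lra.
have -> : \sum_(m < N) v (Zs m om) = tsum Zs v (iota 0 (n.+1 ^ 2)) om +
    tsum Zs v (iota (n.+1 ^ 2) (N - n.+1 ^ 2)) om.
  rewrite -(big_mkord predT (fun m => v (Zs m om))) /index_iota subn0.
  by rewrite -[in LHS](subnKC nN) iotaD big_cat.
have kN : (N - n.+1 ^ 2)%N \in iota 0 (2 * n + 3).
  by rewrite mem_iota/= add0n; move: Nn; rewrite !expnS !expn0; nia.
have tail : tsum Zs v (iota (n.+1 ^ 2) (N - n.+1 ^ 2)) om ^+ 2 <=
    \sum_(k <- iota 0 (2 * n + 3)) tsum Zs v (iota (n.+1 ^ 2) k) om ^+ 2.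
  rewrite (big_rem _ kN)/= lerDl; apply: sumr_ge0 => k _; exact: sqr_ge0.
rewrite /W exprMn [leRHS]mulrCA.
set A := tsum _ _ _ _ in tail *; set B := tsum _ _ _ _ in tail *.
apply: ler_pM; rewrite ?sqr_ge0//.
    rewrite -[4%N]/(2 * 2)%N exprM exprVn.
  rewrite lef_pV2 ?posrE ?exprn_gt0 ?ltr0n//; last first.
    by apply: leq_trans nN; rewrite expn_gt0.
  by rewrite lerXn2r ?nnegrE// -natrX ler_nat.
have := sqr_ge0 (A - B); nra.
Qed.

Lemma slln (f : nat -> R) : L1 (fun om => f (Zs 0%N om) ^+ 2) ->
  {ae Pr, forall om, (fun N => (N%:R)^-1 * \sum_(m < N) f (Zs m om)) @ \oo -->
    Ex (fun om => f (Zs 0%N om))}.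
Proof.
move=> Lf2; set c := Ex _.
have Lf : L1 (fun om => f (Zs 0%N om)) by exact: (L1_sqr Zs_meas Lf2).
pose v z := f z - c.
have Lv2 : L1 (fun om => v (Zs 0%N om) ^+ 2).
  rewrite (_ : (fun om => _) = (fun om => f (Zs 0%N om) ^+ 2 +
    (- (2 * c) * f (Zs 0%N om) + c ^+ 2))).
    by apply/L1D => //; apply: L1D; [exact: L1Z|exact: L1_cst].
  by apply/funext => om; rewrite /v; ring.
have Ev : Ex (fun om => v (Zs 0%N om)) = 0.
  by rewrite ExB//; [rewrite Ex_cst subrr|exact: L1_cst].
apply: filterS (slln_centered Lv2 Ev) => om H.
have {}H : (fun N => (N%:R)^-1 * \sum_(m < N) v (Zs m om) + c) @ \oo --> c.
  by rewrite -[X in _ --> X]add0r; apply: cvgD H (cvg_cst _).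
apply: cvg_trans H; apply: near_eq_cvg.
apply: filterS (nbhs_infty_gt 0%N) => N /= N0.
rewrite /v sumrB sumr_const card_ord -[c *+ N]mulr_natl mulrBr mulrA mulVf.
  by rewrite mul1r subrK.
by rewrite pnatr_eq0 -lt0n.
Qed.

End strong_law.

(** * Bias of a ratio of sample means *)

Lemma itv_dist_le1 (R : realDomainType) (e x y : R) : 0 < e ->
  e <= x <= 1 -> e <= y <= 1 -> `|x - y| <= 1.
Proof.
move=> e0 /andP[ex x1] /andP[ey y1]; rewrite ler_norml; apply/andP; split; lra.
Qed.

Section bias.
Context {R : realType} {dO : measure_display} {Omega : measurableType dO}.
Variables (Pr : probability Omega R) (Zs : nat -> Omega -> nat) (p : nat -> R).
Hypothesis Zs_meas : forall m (A : set nat), measurable (Zs m @^-1` A).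
Hypothesis Zs_law : forall m z, Pr (Zs m @^-1` [set z]) = (p z)%:E.
Hypothesis Zs_indep : mutually_independent Pr Zs.

Local Notation L1 := (L1 Pr).
Local Notation "'Ex' X" := (Rintegral Pr setT X) (at level 10, X at level 8).

Lemma Ex_dist_le (X Y Z : Omega -> R) : L1 X -> L1 Y -> L1 Z ->
  (forall om, `|X om - Y om| <= Z om) -> `|Ex X - Ex Y| <= Ex Z.
Proof.
by move=> LX LY LZ XY; rewrite -ExB//; apply: Ex_abs_le => //; exact: L1B.
Qed.

Variables (w g : nat -> R) (eps : R).
Hypothesis eps0 : 0 < eps.
Hypothesis w_itv : forall z, eps <= w z <= 1.
Hypothesis Lg : L1 (fun om => g (Zs 0%N om)).

Let P := Ex (fun om => w (Zs 0%N om)).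
Let G := Ex (fun om => g (Zs 0%N om)).
Let v z := w z - P.
Let c := Ex (fun om => g (Zs 0%N om) * v (Zs 0%N om)).
Let V := Ex (fun om => v (Zs 0%N om) ^+ 2).

Let Lw m : L1 (fun om => w (Zs m om)).
Proof.
apply: (@L1_boundedZs _ _ _ Pr _ Zs_meas w) => z.
by have /andP[ew w1] := w_itv z; rewrite ger0_norm// (le_trans (ltW eps0)).
Qed.

Lemma mean_itv : eps <= P <= 1.
Proof.
apply/andP; split; [rewrite -[leLHS](Ex_cst Pr)|rewrite -[leRHS](Ex_cst Pr)];
  rewrite /P; (apply: Ex_le => //; [exact: L1_cst|]) => om;
  by have /andP[] := w_itv (Zs 0%N om).
Qed.

Let v1 z : `|v z| <= 1.
Proof.
exact: itv_dist_le1 eps0 (w_itv z) mean_itv.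
Qed.

Let Ev : Ex (fun om => v (Zs 0%N om)) = 0.
Proof. by rewrite ExB//; [rewrite Ex_cst subrr|exact: L1_cst]. Qed.

Let Lv2 : L1 (fun om => v (Zs 0%N om) ^+ 2).
Proof.
by apply: (@L1_boundedZs _ _ _ Pr _ Zs_meas (fun z => v z ^+ 2)) => z;
  exact: normrX_le1.
Qed.

Let Lgm m : L1 (fun om => g (Zs m om)).
Proof. exact: (L1_iid Zs_meas Zs_law m Lg). Qed.

Let Lgv m : L1 (fun om => g (Zs m om) * v (Zs m om)).
Proof.
apply: (L1_le _ (Lgm m)).
  exact: (measurable_Zs Zs_meas (fun z => g z * v z)).
by move=> om; rewrite normrM ler_piMr.
Qed.

(** The leave-one-out mean: n samples but divisor n+1, the missing weight being replaced by its
    expectation [P]. It takes a list of values so that it composes with [tup]. *)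
Definition shrunk_mean (n : nat) (t : seq nat) : R :=
  P + n.+1%:R^-1 * \sum_(x <- t) v x.

Lemma shrunk_meanE n s om :
  shrunk_mean n (tup Zs s om) = P + n.+1%:R^-1 * tsum Zs v s om.
Proof. by rewrite /shrunk_mean -tsumE. Qed.

(** It is the average of [P] and n weights, all in the interval. *)
Lemma shrunk_mean_itv n t : size t = n -> eps <= shrunk_mean n t <= 1.
Proof.
move=> tn; have /andP[eP P1] := mean_itv.
have n0 : 0 < n.+1%:R :> R by rewrite ltr0n.
have -> : shrunk_mean n t = n.+1%:R^-1 * (P + \sum_(x <- t) w x).
  rewrite /shrunk_mean /v sumrB big_const_seq count_predT tn iter_addr addr0.
  rewrite -[P *+ n]mulr_natl -(natr1 n) in n0 *.
  by move: n%:R (\sum_(_ <- _) _) n0 => x y x0; field; rewrite lt0r_neq0.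
have lo : eps *+ n <= \sum_(x <- t) w x.
  rewrite -tn -[_ *+ _]addr0 -iter_addr -(count_predT t) -big_const_seq.
  by apply: ler_sum => x _; have /andP[] := w_itv x.
have hi : \sum_(x <- t) w x <= 1 *+ n.
  rewrite -tn -[_ *+ _]addr0 -iter_addr -(count_predT t) -big_const_seq.
  by apply: ler_sum => x _; have /andP[] := w_itv x.
rewrite ler_pdivlMl// ler_pdivrMl// mulr1 -natr1 mulrDl mul1r mulr_natl.
by apply/andP; split; rewrite addrC; apply: lerD.
Qed.

Let shrunk_itv n s om : size s = n -> eps <= shrunk_mean n (tup Zs s om) <= 1.
Proof. by move=> sn; apply: shrunk_mean_itv; rewrite size_map. Qed.

Lemma L1_shrunk_powR r n s : size s = n ->
  L1 (fun om => shrunk_mean n (tup Zs s om) `^ r).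
Proof.
move=> sn; have [K HK] := @powR_bounded _ eps 1 eps0 r.
apply: (@L1_bounded _ _ _ _ _ K).
  exact: (measurable_tup Zs_meas (fun t => shrunk_mean n t `^ r)).
by move=> om; apply: HK; exact: shrunk_itv.
Qed.

Let L1_dX s n : L1 (fun om => tsum Zs v s om ^+ n).
Proof. exact: L1_tsumX. Qed.

Let L1_shr k n s : L1 (fun om => (shrunk_mean n (tup Zs s om) - P) ^+ k).
Proof.
rewrite (_ : (fun om => _) = (fun om => n.+1%:R^-1 ^+ k * tsum Zs v s om ^+ k)).
  exact: L1Z.
by apply/funext => om; rewrite shrunk_meanE addrC addKr exprMn.
Qed.

Let Ex_shr k n s : Ex (fun om => (shrunk_mean n (tup Zs s om) - P) ^+ k) =
  n.+1%:R^-1 ^+ k * Ex (fun om => tsum Zs v s om ^+ k).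
Proof.
rewrite -ExZ//; apply: eq_Rintegral => om _.
by rewrite shrunk_meanE addrC addKr exprMn.
Qed.

Let V01 : 0 <= V <= 1.
Proof.
rewrite Ex_ge0/=; last by move=> om; exact: sqr_ge0.
rewrite -[leRHS](Ex_cst Pr); apply: Ex_le => //; first exact: L1_cst.
by move=> om; apply: le_trans (ler_norm _) _; exact: normrX_le1.
Qed.

Let Ex_shr1 n s : Ex (fun om => shrunk_mean n (tup Zs s om) - P) = 0.
Proof. by rewrite (Ex_shr 1) (Ex_tsum Zs_meas Zs_law Lv2 Ev) mulr0. Qed.

(** The linear Taylor term has mean zero, so the error has the order of the variance, 1/M, and not
    of the standard deviation. *)
Lemma Ex_shrunk_powR1 r : exists2 K, 0 <= K & forall n s, uniq s -> size s = n ->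
  `|Ex (fun om => shrunk_mean n (tup Zs s om) `^ r) - P `^ r| <= K * n.+1%:R^-1.
Proof.
have [K K0 HK] := @powR_taylor2 _ eps 1 eps0 r.
exists K => // n s us sn.
have -> : P `^ r = Ex (fun om => P `^ r +
    r * P `^ (r - 1) * (shrunk_mean n (tup Zs s om) - P)).
  rewrite ExD; [|exact: L1_cst|by apply: L1Z; exact: (L1_shr 1)].
  by rewrite ExZ ?Ex_shr1 ?mulr0 ?addr0 ?Ex_cst//; exact: (L1_shr 1).
apply: (@le_trans _ _ (Ex (fun om => K * (shrunk_mean n (tup Zs s om) - P) ^+ 2))).
  apply: Ex_dist_le.
  - exact: L1_shrunk_powR.
  - by apply: L1D; [exact: L1_cst|apply: L1Z; exact: (L1_shr 1)].
  - exact: L1Z.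
  - move=> om; rewrite opprD addrA.
    rewrite -[(_ - P) ^+ 2]real_normK ?num_real//.
    by apply: HK; [exact: mean_itv|exact: shrunk_itv].
rewrite ExZ// Ex_shr (tsum_sqr Zs_meas Zs_law Zs_indep Lv2 Ev us).2 sn.
have n0 : 0 < n.+1%:R :> R by rewrite ltr0n.
apply: ler_wpM2l => //; rewrite expr2 -mulrA ler_piMr ?invr_ge0 ?(ltW n0)//.
rewrite ler_pdivrMl// mulr1; have /andP[V0 V1] := V01.
by apply: le_trans (ler_piMr _ V1) _; rewrite ?ler_nat.
Qed.

Lemma Ex_shrunk_powR2 r : exists2 K, 0 <= K & forall n s, uniq s -> size s = n ->
  `|Ex (fun om => shrunk_mean n (tup Zs s om) `^ r)
    - (P `^ r + n.+1%:R^-1 * (r * (r - 1) * P `^ (r - 1 - 1) / 2 * V))|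
  <= K * n.+1%:R^-1 ^+ 2.
Proof.
have [K K0 HK] := @powR_taylor4 _ eps 1 eps0 r.
pose B := r * (r - 1) * P `^ (r - 1 - 1) / 2.
pose C := r * (r - 1) * (r - 1 - 1) * P `^ (r - 1 - 1 - 1) / 6.
(* The factor 3 is that of the fourth-moment bound, [C] weighs the third moment, and [B] pays for
   replacing n/(n+1)^2 by 1/(n+1) in front of the variance. *)
exists (K * 3 + `|C| + `|B|); first by rewrite !addr_ge0 ?mulr_ge0.
move=> n s us sn; rewrite -/B.
pose D om := shrunk_mean n (tup Zs s om) - P.
pose A := r * P `^ (r - 1).
pose T om := P `^ r + (A * D om ^+ 1 + (B * D om ^+ 2 + C * D om ^+ 3)).
have LD k : L1 (fun om => D om ^+ k) by exact: L1_shr.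
have LT : L1 T by do ?[exact: L1_cst|exact: L1Z|apply: L1D].
have n0 : 0 < n.+1%:R :> R by rewrite ltr0n.
have i0 : 0 <= n.+1%:R^-1 :> R by rewrite invr_ge0 ltW.
have i1 : n%:R * n.+1%:R^-1 <= 1 :> R by rewrite ler_pdivrMr// mul1r ler_nat.
have j0 : 0 <= n%:R * n.+1%:R^-1 :> R by rewrite mulr_ge0.
have step1 : `|Ex (fun om => shrunk_mean n (tup Zs s om) `^ r) - Ex T| <=
    K * 3 * n.+1%:R^-1 ^+ 2.
  apply: (@le_trans _ _ (Ex (fun om => K * D om ^+ 4))).
    apply: Ex_dist_le => //; [exact: L1_shrunk_powR|exact: L1Z|move=> om].
    rewrite -[D om ^+ 4]ger0_norm; last by rewrite exprn_even_ge0.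
    rewrite normrX /T !opprD !addrA.
    by apply: HK; [exact: mean_itv|exact: shrunk_itv].
  rewrite ExZ// -mulrA ler_wpM2l// Ex_shr.
  have := tsum_fourth Zs_meas Zs_law Zs_indep v1 Ev us; rewrite sn => H.
  apply: le_trans (ler_wpM2l _ H) _; first exact: exprn_ge0.
  move: i0 i1 j0; set x := n.+1%:R^-1; set y := n%:R => x0 yx1 yx0.
  have -> : x ^+ 4 * (3 * y ^+ 2) = 3 * ((y * x) ^+ 2 * x ^+ 2) by ring.
  by rewrite ler_wpM2l// ler_piMl ?sqr_ge0// expr_le1.
have mu3 : `|Ex (fun om => v (Zs 0%N om) ^+ 3)| <= 1.
  rewrite -[leRHS](Ex_cst Pr); apply: Ex_abs_le.
  - apply: (@L1_boundedZs _ _ _ Pr _ Zs_meas (fun z => v z ^+ 3)) => z.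
    exact: normrX_le1.
  - exact: L1_cst.
  - by move=> om; exact: normrX_le1.
have ET : Ex T = P `^ r + (B * (n.+1%:R^-1 ^+ 2 * (n%:R * V)) +
    C * (n.+1%:R^-1 ^+ 3 * (n%:R * Ex (fun om => v (Zs 0%N om) ^+ 3)))).
  rewrite /T ExD; [|exact: L1_cst|by do ?[exact: L1Z|apply: L1D]].
  rewrite Ex_cst ExD; [|exact: L1Z|by do ?[exact: L1Z|apply: L1D]].
  rewrite ExD; [|exact: L1Z|exact: L1Z].
  rewrite (ExZ A)// (ExZ B)// (ExZ C)// /D Ex_shr1 !Ex_shr mulr0 add0r.
  rewrite (tsum_sqr Zs_meas Zs_law Zs_indep Lv2 Ev us).2.
  by rewrite (tsum_cube Zs_meas Zs_law Zs_indep v1 Ev us) sn.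
have step2 : `|Ex T - (P `^ r + n.+1%:R^-1 * (B * V))| <=
    (`|C| + `|B|) * n.+1%:R^-1 ^+ 2.
  rewrite ET; set mu := Ex _ in mu3 *.
  have -> : P `^ r + (B * (n.+1%:R^-1 ^+ 2 * (n%:R * V)) +
      C * (n.+1%:R^-1 ^+ 3 * (n%:R * mu))) - (P `^ r + n.+1%:R^-1 * (B * V)) =
      C * (n.+1%:R^-1 ^+ 2 * ((n%:R * n.+1%:R^-1) * mu)) - B * (n.+1%:R^-1 ^+ 2 * V).
    rewrite -(natr1 n) in n0 *; move: (n%:R) n0 (P `^ r) => x x0 y.
    by field; rewrite lt0r_neq0.
  apply: le_trans (ler_normB _ _) _; rewrite mulrDl; apply: lerD.
    rewrite normrM ler_wpM2l// normrM (ger0_norm (exprn_ge0 _ i0)).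
    by rewrite ler_piMr ?exprn_ge0// normrM mulr_ile1// ger0_norm.
  rewrite normrM ler_wpM2l// normrM (ger0_norm (exprn_ge0 _ i0)).
  by have /andP[V0 V1] := V01; rewrite ler_piMr ?exprn_ge0// ger0_norm.
rewrite -addrA mulrDl -[X in `|X|](subrKA (Ex T)).
exact: le_trans (ler_normD _ _) (lerD step1 step2).
Qed.

Lemma Ex_weighted_shrunk r m n s : uniq (m :: s) -> size s = n ->
  L1 (fun om => g (Zs m om) * shrunk_mean n (tup Zs s om) `^ r) /\
  L1 (fun om => (g (Zs m om) * v (Zs m om)) * shrunk_mean n (tup Zs s om) `^ r) /\
  Ex (fun om => g (Zs m om) * shrunk_mean n (tup Zs s om) `^ r) =
    G * Ex (fun om => shrunk_mean n (tup Zs s om) `^ r) /\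
  Ex (fun om => (g (Zs m om) * v (Zs m om)) * shrunk_mean n (tup Zs s om) `^ r) =
    c * Ex (fun om => shrunk_mean n (tup Zs s om) `^ r).
Proof.
move=> us sn; have LF := L1_shrunk_powR r sn.
split; first exact: (L1_indep_tup Zs_meas Zs_indep us (Lgm m)
  (F := fun t => shrunk_mean n t `^ r) LF).
split; first exact: (L1_indep_tup Zs_meas Zs_indep us
  (f := fun z => g z * v z) (F := fun t => shrunk_mean n t `^ r) (Lgv m) LF).
split.
  rewrite (Ex_indep_tup Zs_meas Zs_indep us (Lgm m)
    (F := fun t => shrunk_mean n t `^ r) LF).
  by rewrite (Ex_iid Zs_meas Zs_law 0%N (Lgm m)).
rewrite (Ex_indep_tup Zs_meas Zs_indep us
  (f := fun z => g z * v z) (F := fun t => shrunk_mean n t `^ r) (Lgv m) LF).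
by rewrite (Ex_iid Zs_meas Zs_law (f := fun z => g z * v z) 0%N (Lgv m)).
Qed.

Definition sample_mean (f : nat -> R) (M : nat) (om : Omega) :=
  M%:R^-1 * \sum_(m < M) f (Zs m om).

Lemma sample_mean_split n m s om : perm_eq (m :: s) (iota 0 n.+1) ->
  sample_mean w n.+1 om =
  shrunk_mean n (tup Zs s om) + n.+1%:R^-1 * v (Zs m om).
Proof.
move=> ms; rewrite /sample_mean shrunk_meanE.
have n0 : 0 < n.+1%:R :> R by rewrite ltr0n.
have E : \sum_(j < n.+1) v (Zs j om) = v (Zs m om) + tsum Zs v s om.
  rewrite -(big_mkord predT (fun j => v (Zs j om))) /index_iota subn0.
  by rewrite -(perm_big _ ms)/= big_cons.
have -> : \sum_(j < n.+1) w (Zs j om) = \sum_(j < n.+1) v (Zs j om) + P *+ n.+1.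
  by rewrite /v sumrB sumr_const card_ord subrK.
rewrite E -[P *+ _]mulr_natl; move: n.+1%:R n0 => x x0.
by field; rewrite lt0r_neq0.
Qed.

Lemma sample_mean_itv n om : eps <= sample_mean w n.+1 om <= 1.
Proof.
rewrite /sample_mean ler_pdivlMl ?ltr0n// ler_pdivrMl ?ltr0n// mulr1.
have -> : n.+1%:R * eps = \sum_(m < n.+1) eps.
  by rewrite sumr_const card_ord mulr_natl.
have -> : n.+1%:R = \sum_(m < n.+1) 1 :> R by rewrite sumr_const card_ord.
by apply/andP; split; apply: ler_sum => m _; have /andP[] := w_itv (Zs m om).
Qed.

Lemma measurable_sample_mean f M : measurable_fun setT (sample_mean f M).
Proof.
apply: measurable_funM; first exact: measurable_cst.
apply: measurable_sum => m; exact: (measurable_Zs Zs_meas).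
Qed.

Lemma measurable_sample_powR f M r :
  measurable_fun setT (fun om => sample_mean f M om `^ r).
Proof.
apply: (measurableT_comp (measurable_powR r)).
exact: measurable_sample_mean.
Qed.

Lemma L1_weighted_mean r m n : L1 (fun om => g (Zs m om) * sample_mean w n.+1 om `^ r).
Proof.
have [K HK] := @powR_bounded _ eps 1 eps0 r.
apply: (L1_le _ (L1Z K (Lgm m))).
  apply: measurable_funM; first exact: (measurable_Zs Zs_meas).
  exact: measurable_sample_powR.
move=> om; rewrite !normrM mulrC ler_wpM2r//.
exact: le_trans (HK _ (sample_mean_itv n om)) (ler_norm _).
Qed.

Lemma weighted_mean_expansion r : exists2 K, 0 <= K & forall n m, (m < n.+1)%N ->
  `|Ex (fun om => g (Zs m om) * sample_mean w n.+1 om `^ r)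
    - (G * P `^ r + n.+1%:R^-1 * (G * (r * (r - 1) * P `^ (r - 1 - 1) / 2 * V)
        + c * (r * P `^ (r - 1))))|
  <= K * n.+1%:R^-1 ^+ 2.
Proof.
have [K2 K20 HK2] := @powR_taylor2 _ eps 1 eps0 r.
have [Ka Ka0 HKa] := Ex_shrunk_powR2 r.
have [Kb Kb0 HKb] := Ex_shrunk_powR1 (r - 1).
pose Eg := Ex (fun om => `|g (Zs 0%N om)|).
have Eg0 : 0 <= Eg by exact: Ex_ge0.
(* In order: the Taylor remainder at the leave-one-out mean, the error in the mean of its power [r],
   and the error in the mean of the derivative, which already carries a factor 1/M. *)
exists (K2 * Eg + `|G| * Ka + `|c * r| * Kb); first by rewrite !addr_ge0 ?mulr_ge0.
move=> n m mn; pose s := rem m (iota 0 n.+1).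
have min : m \in iota 0 n.+1 by rewrite mem_iota.
have ms : perm_eq (m :: s) (iota 0 n.+1) by rewrite perm_sym perm_to_rem.
have us : uniq (m :: s) by rewrite (perm_uniq ms) iota_uniq.
have sn : size s = n by rewrite size_rem// size_iota.
have {}HKa := HKa n s (andP us).2 sn.
have {}HKb := HKb n s (andP us).2 sn.
have [L1a [_ [E1 _]]] := Ex_weighted_shrunk r us sn.
have [_ [L1b [_ E2]]] := Ex_weighted_shrunk (r - 1) us sn.
set x := n.+1%:R^-1 in HKa HKb *.
have x0 : 0 <= x by rewrite invr_ge0.
pose a om := shrunk_mean n (tup Zs s om).
(* First-order Taylor polynomial of the power at [a om], weighted by the gradient sample; each part
   is a function of sample [m] times a function of the others. *)
pose T om := g (Zs m om) * a om `^ r +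
  x * r * (g (Zs m om) * v (Zs m om) * a om `^ (r - 1)).
have LT : L1 T by apply: L1D => //; exact: L1Z.
have step : `|Ex (fun om => g (Zs m om) * sample_mean w n.+1 om `^ r) - Ex T| <=
    K2 * Eg * x ^+ 2.
  rewrite mulrAC -[Eg](Ex_iid Zs_meas Zs_law (f := fun z => `|g z|) 0%N
    (L1_abs (Lgm m))).
  rewrite -ExZ; last exact: L1_abs.
  apply: Ex_dist_le => //; [exact: L1_weighted_mean|by apply: L1Z; exact: L1_abs|].
  move=> om; rewrite /T (sample_mean_split _ ms) -/x -/(a om).
  set b := a om + _.
  have bE : b - a om = x * v (Zs m om) by rewrite /b addrC addKr.
  have -> : g (Zs m om) * b `^ r - (g (Zs m om) * a om `^ r +
      x * r * (g (Zs m om) * v (Zs m om) * a om `^ (r - 1))) =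
      (b `^ r - a om `^ r - r * a om `^ (r - 1) * (b - a om) ^+ 1) * g (Zs m om).
    by rewrite bE; ring.
  rewrite normrM ler_wpM2r//.
  have bI : eps <= b <= 1 by rewrite /b /x -(sample_mean_split _ ms) sample_mean_itv.
  apply: le_trans (HK2 _ _ (shrunk_itv om sn) bI) _.
  rewrite ler_wpM2l// bE normrM (ger0_norm x0) exprMn ler_piMr ?sqr_ge0//.
  by rewrite expr_le1.
have ET : Ex T = G * Ex (fun om => a om `^ r) +
    x * r * (c * Ex (fun om => a om `^ (r - 1))).
  by rewrite /T ExD//; [rewrite ExZ// E1 E2|exact: L1Z].
apply: le_trans (ler_distD (Ex T) _ _) _.
have -> : (K2 * Eg + `|G| * Ka + `|c * r| * Kb) * x ^+ 2 =
  K2 * Eg * x ^+ 2 + (`|G| * Ka * x ^+ 2 + `|c * r| * Kb * x ^+ 2) by ring.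
apply: lerD step _.
rewrite ET -/(a _) in HKa HKb *.
set Ea := Ex _ in HKa *; set Eb := Ex _ in HKb *.
have -> : G * Ea + x * r * (c * Eb) - (G * P `^ r +
    x * (G * (r * (r - 1) * P `^ (r - 1 - 1) / 2 * V) + c * (r * P `^ (r - 1)))) =
    G * (Ea - (P `^ r + x * (r * (r - 1) * P `^ (r - 1 - 1) / 2 * V))) +
    c * r * (x * (Eb - P `^ (r - 1))) by ring.
apply: le_trans (ler_normD _ _) _; apply: lerD.
  by rewrite normrM -[leRHS]mulrA ler_wpM2l.
rewrite [leLHS]normrM -[leRHS]mulrA ler_wpM2l// [leLHS]normrM (ger0_norm x0).
have -> : Kb * x ^+ 2 = x * (Kb * x) by ring.
by rewrite ler_wpM2l.
Qed.

(** The constant for a single sample is uniform in [m], so averaging over [m] preserves the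
    expansion. *)
Lemma ratio_mean_expansion r : exists2 K, 0 <= K & forall M, (0 < M)%N ->
  `|Ex (fun om => sample_mean g M om * sample_mean w M om `^ r)
    - (G * P `^ r + M%:R^-1 * (G * (r * (r - 1) * P `^ (r - 1 - 1) / 2 * V)
        + c * (r * P `^ (r - 1))))|
  <= K * M%:R^-1 ^+ 2.
Proof.
have [K K0 HK] := weighted_mean_expansion r; exists K => // -[//|n] _.
set T := (X in `|_ - X|).
have -> : Ex (fun om => sample_mean g n.+1 om * sample_mean w n.+1 om `^ r) =
    n.+1%:R^-1 * \sum_(m < n.+1) 
      Ex (fun om => g (Zs m om) * sample_mean w n.+1 om `^ r).
  rewrite -Ex_sum; last by move=> m; exact: L1_weighted_mean.
  rewrite -ExZ; last by apply: L1_sum_ord => m; exact: L1_weighted_mean.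
  by apply: eq_Rintegral => om _; rewrite -mulrA mulr_suml.
have n0 : 0 < n.+1%:R :> R by rewrite ltr0n.
have -> : T = n.+1%:R^-1 * \sum_(m < n.+1) T.
  by rewrite sumr_const card_ord -[T *+ _]mulr_natl mulKf// lt0r_neq0.
rewrite -mulrBr -sumrB normrM ger0_norm ?invr_ge0 ?(ltW n0)//.
rewrite ler_pdivrMl//; set B := K * _.
have -> : n.+1%:R * B = \sum_(m < n.+1) B by rewrite sumr_const card_ord mulr_natl.
by apply: le_trans (ler_norm_sum _ _ _) _; apply: ler_sum => m _; exact: HK.
Qed.

End bias.

(** * The Tsallis gradient estimator *)

Section euclidean_norm.
Context {R : realType} {d : nat}.
Implicit Types u v : 'rV[R]_d.

Lemma enorm_ge0 u : 0 <= enorm u.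
Proof. exact: sqrtr_ge0. Qed.

Lemma enorm_sqr u : enorm u ^+ 2 = \sum_(i < d) u 0 i ^+ 2.
Proof. by rewrite sqr_sqrtr// sumr_ge0// => i _; exact: sqr_ge0. Qed.

Lemma enormZ a u : enorm (a *: u) = `|a| * enorm u.
Proof.
rewrite -[`|a|]sqrtr_sqr /enorm -sqrtrM ?sqr_ge0//; congr Num.sqrt.
by rewrite mulr_sumr; apply: eq_bigr => i _; rewrite mxE exprMn.
Qed.

Lemma enormN u : enorm (- u) = enorm u.
Proof. by rewrite -scaleN1r enormZ normrN1 mul1r. Qed.

Lemma enorm_le_sqrt u (k : 'I_d -> R) (c : R) : 0 <= c ->
  (forall i, `|u 0 i| <= k i * c) ->
  enorm u <= Num.sqrt (\sum_(i < d) k i ^+ 2) * c.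
Proof.
move=> c0 uk; rewrite -[X in _ * X](ger0_norm c0) -sqrtr_sqr -sqrtrM; last first.
  by apply: sumr_ge0 => i _; exact: sqr_ge0.
apply: ler_wsqrtr; rewrite mulr_suml; apply: ler_sum => i _.
rewrite -exprMn -real_normK ?num_real// lerXn2r ?nnegrE//.
exact: le_trans (uk i).
Qed.

(** Cauchy-Schwarz: with a and b the two norms, the sum of the squares of b u_i - a v_i equals 2ab
    (ab - u.v). Vanishing norms are treated apart to allow division by ab. *)
Lemma dot_le_enorm u v : \sum_(i < d) u 0 i * v 0 i <= enorm u * enorm v.
Proof.
set a := enorm u; set b := enorm v.
have a0 : 0 <= a by exact: enorm_ge0.
have b0 : 0 <= b by exact: enorm_ge0.
have zero x y : enorm x = 0 -> \sum_(i < d) x 0 i * y 0 i = 0 :> R.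
  move=> x0; have := enorm_sqr x; rewrite x0 expr0n/= => /esym/eqP.
  rewrite psumr_eq0; last by move=> i _; exact: sqr_ge0.
  move=> /allP H; rewrite big1// => i _.
  by have := H i (mem_index_enum i); rewrite /= sqrf_eq0 => /eqP ->; rewrite mul0r.
have [A0|A0] := eqVneq a 0; first by rewrite zero// A0 mul0r.
have [B0|B0] := eqVneq b 0.
  by under eq_bigr do rewrite mulrC; rewrite zero// B0 mulr0.
have H : 0 <= \sum_(i < d) (b * u 0 i - a * v 0 i) ^+ 2.
  by apply: sumr_ge0 => i _; exact: sqr_ge0.
have E : \sum_(i < d) (b * u 0 i - a * v 0 i) ^+ 2 =
    b ^+ 2 * \sum_(i < d) u 0 i ^+ 2 - 2 * a * b * \sum_(i < d) u 0 i * v 0 i +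
    a ^+ 2 * \sum_(i < d) v 0 i ^+ 2.
  rewrite !mulr_sumr -sumrB -big_split/=; apply: eq_bigr => i _; ring.
move: H; rewrite E -!enorm_sqr -/a -/b; set S := \sum_(i < d) _ => H.
have ab : 0 < 2 * (a * b) by rewrite mulr_gt0// mulr_gt0// lt0r ?A0 ?B0.
by rewrite -subr_ge0 -(pmulr_rge0 _ ab); apply: le_trans H _; nra.
Qed.

Lemma enormD u v : enorm (u + v) <= enorm u + enorm v.
Proof.
rewrite -(@ler_pXn2r _ 2)// ?nnegrE ?addr_ge0 ?enorm_ge0//.
rewrite enorm_sqr sqrrD !enorm_sqr.
have -> : \sum_(i < d) (u + v) 0 i ^+ 2 = \sum_(i < d) u 0 i ^+ 2 +
    (\sum_(i < d) u 0 i * v 0 i) *+ 2 + \sum_(i < d) v 0 i ^+ 2.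
  rewrite -mulr_natl mulr_sumr -!big_split/=; apply: eq_bigr => i _.
  by rewrite mxE; ring.
by rewrite lerD2r lerD2l lerMn2r dot_le_enorm.
Qed.

Lemma cvg_rV (F : nat -> 'rV[R]_d) (l : 'rV[R]_d) :
  (forall i, (fun n => F n 0 i) @ \oo --> l 0 i) -> F @ \oo --> l.
Proof.
move=> Fl; apply/cvg_ballP => e e0.
have : \forall n \near \oo, forall i : 'I_d, ball (l 0 i) e (F n 0 i).
  by apply: filter_forall => i; have /cvg_ballP/(_ e e0) := Fl i.
apply: filterS => n H; split => // i j; rewrite ord1; exact: H.
Qed.

End euclidean_norm.

Section tsallis_gradient.
Context {R : realType}.

(** Both branches of [logq] have the same derivative, so q = 1 needs no separate treatment
    afterwards. *)
Lemma is_derive_logq (q u : R) : 0 < u -> is_derive u 1 (logq q) (u `^ (- q)).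
Proof.
move=> u0; rewrite /logq; have [->|q1] := eqVneq q 1.
  by rewrite powR_inv1 ?(ltW u0)//; exact: is_derive1_ln.
have q10 : 1 - q != 0 by rewrite subr_eq0 eq_sym.
have := is_deriveZ (1 - q)^-1 (is_derive_powRB (1 - q) 1 u0).
set D := (X in is_derive _ _ _ X -> _).
have -> : D = u `^ (- q).
  by rewrite /D /GRing.scale/= mulrA mulVf// mul1r addrAC subrr add0r.
congr (is_derive _ _ _ _); apply/funext => x.
by rewrite /GRing.scale/= mulrC.
Qed.

Lemma partial_comp {d} (f : 'rV[R]_d -> R) a i (h : R -> R) dh :
  derivable f a (delta_mx 0 i) -> is_derive (f a) 1 h dh ->
  partial i (fun x => h (f x)) a = dh * partial i f a.
Proof.
move=> df dhf.
by have [_ <-] := is_derive_comp1 (derivableP df) dhf.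
Qed.

End tsallis_gradient.

Section model.
Context {R : realType} {d : nat} (pz py : 'rV[R]_d -> nat -> R).
Hypothesis pz_ge0 : forall th z, 0 <= pz th z.
Hypothesis pz_sum1 : forall th, (\sum_(0 <= z <oo) (pz th z)%:E = 1)%E.
Hypothesis py_01 : forall th z, 0 <= py th z <= 1.
Variables (theta : 'rV[R]_d) (dO : measure_display) (Omega : measurableType dO).
Variables (Pr : probability Omega R) (Zs : nat -> Omega -> nat).
Hypothesis Zs_meas : forall m (A : set nat), measurable (Zs m @^-1` A).
Hypothesis Zs_law : forall m z, Pr (Zs m @^-1` [set z]) = (pz theta z)%:E.
Hypothesis hJ : forall z, partials_exist (fun th => joint pz py th z) theta.
Hypothesis hP : partials_exist (marginal pz py) theta.
Hypothesis hswap : forall i : 'I_d,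
     series (fun z => partial i (fun th => joint pz py th z) theta) @ \oo
       --> partial i (marginal pz py) theta.
Hypothesis hP0 : 0 < marginal pz py theta.
Hypothesis hg2 : forall m,
     ('E_Pr[fun om => (enorm (gm pz py theta Zs m om) ^+ 2)%R] < +oo)%E.
Variable eps : R.
Hypothesis heps : 0 < eps.
Hypothesis hw : forall m, {ae Pr, forall om, eps <= wm py theta Zs m om}.

Local Notation L1 := (L1 Pr).
Local Notation "'Ex' X" := (Rintegral Pr setT X) (at level 10, X at level 8).
Local Notation P := (marginal pz py theta).

Definition score z := grad (fun th => ln (joint pz py th z)) theta.

(* Weight and gradient sample, altered on the latents of probability zero so
   that the bounds hold for every latent. *)
Definition wt z := if 0 < pz theta z then py theta z else 1.
Definition gt i z := if 0 < pz theta z then - py theta z * score z 0 i else 0.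

Lemma exists_latent : exists z, 0 < pz theta z.
Proof.
apply: contrapT => H; have := pz_sum1 theta.
rewrite eseries0 => [/esym/eqP|z _ _]; first by rewrite onee_eq0.
congr EFin; apply/eqP; rewrite eq_le pz_ge0 andbT leNgt.
by apply/negP => z0; apply: H; exists z.
Qed.

(** A latent of positive probability is an atom, which no null set can contain, so the almost sure
    bound holds there pointwise. *)
Lemma eps_le_py z : 0 < pz theta z -> eps <= py theta z.
Proof.
move=> z0; have [N [mN N0 HN]] := hw 0%N.
apply: contrapT => nle; have := Zs_law 0%N z.
have : (Pr (Zs 0%N @^-1` [set z]) <= 0)%E.
  rewrite -N0 le_measure ?inE//.
  by apply: subset_trans HN => om /= E; rewrite /wm E.
by move=> /[swap] ->; rewrite lee_fin leNgt z0.
Qed.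

(** The default weight 1 is at least [eps], because some latent of positive probability has a weight
    between them. *)
Lemma wt_itv z : eps <= wt z <= 1.
Proof.
rewrite /wt; case: ifPn => [z0|_].
  by rewrite eps_le_py//=; have /andP[] := py_01 theta z.
have [y y0] := exists_latent; rewrite lexx andbT.
by apply: le_trans (eps_le_py y0) _; have /andP[] := py_01 theta y.
Qed.

(** The exceptional set is a countable union, over samples and latents, of null fibers. *)
Lemma ae_latent_gt0 : {ae Pr, forall om, forall m, 0 < pz theta (Zs m om)}.
Proof.
apply: ae_foralln => m.
have : Pr.-negligible (\bigcup_k
      (if 0 < pz theta k then set0 else Zs m @^-1` [set k])).
  apply: negligible_bigcup => k; case: ifPn => [_|k0]; first exact: negligible_set0.
  apply/negligibleP => //; apply: etrans (Zs_law m k) _; congr EFin; apply/eqP.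
  by rewrite eq_le pz_ge0 andbT leNgt.
apply: negligibleS => om /= H; exists (Zs m om) => //.
by case: ifPn.
Qed.

Lemma joint_wt z : joint pz py theta z = wt z * pz theta z.
Proof.
rewrite /joint /wt mulrC; case: ifPn => // z0.
suff -> : pz theta z = 0 by rewrite !mulr0.
by apply/eqP; rewrite eq_le pz_ge0 andbT leNgt.
Qed.

Lemma Ex_wt : Ex (fun om => wt (Zs 0%N om)) = P.
Proof.
have w0 z : (0 <= (wt z)%:E)%E.
  by rewrite lee_fin; have /andP[/(le_trans (ltW heps))] := wt_itv z.
rewrite /Rintegral (ge0_integral_discrete Pr (Zs_meas 0%N) measurableT w0).
congr fine; apply: eq_eseriesr => z _.
by rewrite setTI Zs_law joint_wt.
Qed.

(** Log-derivative identity: the joint density times the derivative of its logarithm is its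
    derivative. *)
Lemma gt_law i z : gt i z * pz theta z =
  - partial i (fun th => joint pz py th z) theta.
Proof.
rewrite /gt; case: ifPn => z0.
  have y0 : 0 < py theta z by exact: lt_le_trans (eps_le_py z0).
  have j0 : 0 < joint pz py theta z by rewrite mulr_gt0.
  rewrite /score mxE (partial_comp (@hJ z i) (is_derive1_ln j0)).
  by rewrite /joint; field; rewrite !lt0r_neq0.
have pz0 : pz theta z = 0 by apply/eqP; rewrite eq_le pz_ge0 andbT leNgt.
rewrite mul0r /partial (derive_at_min (@hJ z i)) ?oppr0// => th.
by rewrite /joint pz0 mul0r mulr_ge0//; have /andP[] := py_01 th z.
Qed.

Lemma gm_coord m om i : gm pz py theta Zs m om 0 i =
  - py theta (Zs m om) * score (Zs m om) 0 i.
Proof. by rewrite /gm mxE. Qed.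

Lemma gt_sqr_le i m om :
  `|gt i (Zs m om) ^+ 2| <= `|enorm (gm pz py theta Zs m om) ^+ 2|.
Proof.
rewrite !ger0_norm ?sqr_ge0// enorm_sqr (bigD1 i)//=.
apply: (@le_trans _ _ (gm pz py theta Zs m om 0 i ^+ 2)).
  by rewrite gm_coord /gt; case: ifP; rewrite // expr0n sqr_ge0.
by rewrite lerDl; apply: sumr_ge0 => j _; exact: sqr_ge0.
Qed.

Lemma L1_gt_sqr i : L1 (fun om => gt i (Zs 0%N om) ^+ 2).
Proof.
apply: (@L1_le _ _ _ _ _ (fun om => enorm (gm pz py theta Zs 0 om) ^+ 2)).
- exact: (measurable_Zs Zs_meas (fun z => gt i z ^+ 2)).
- apply/integrableP; split.
    apply/measurable_EFinP.
    exact: (measurable_Zs Zs_meas (fun z => enorm (- py theta z *: score z) ^+ 2)).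
  have := hg2 0%N; rewrite unlock.
  by under eq_integral do rewrite -[X in X%:E]ger0_norm ?sqr_ge0//.
- exact: gt_sqr_le.
Qed.

Lemma L1_gt i : L1 (fun om => gt i (Zs 0%N om)).
Proof. exact: (L1_sqr Zs_meas (L1_gt_sqr i)). Qed.

Lemma Ex_gt i : Ex (fun om => gt i (Zs 0%N om)) =
  - partial i (marginal pz py) theta.
Proof.
rewrite -(cvg_lim _ (Ex_law Zs_meas Zs_law (L1_gt i)))//.
apply: cvg_lim => //.
have -> : series (fun z => gt i z * pz theta z) =
    - series (fun z => partial i (fun th => joint pz py th z) theta).
  by rewrite -seriesN; congr series; apply/funext => z; rewrite gt_law.
exact: cvgN.
Qed.

Lemma grad_ell q i : grad (ell pz py q) theta 0 i =
  Ex (fun om => gt i (Zs 0%N om)) * P `^ (- q).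
Proof.
rewrite Ex_gt mxE.
have D : is_derive P 1 (fun u => - logq q u) (- P `^ (- q)).
  exact: is_deriveN (is_derive_logq q hP0).
by rewrite (partial_comp (@hP i) D) mulNr mulrC mulNr.
Qed.

Lemma grad_ell1 : grad (ell pz py 1) theta =
  - grad (fun th => ln (marginal pz py th)) theta.
Proof.
apply/rowP => i; rewrite grad_ell Ex_gt !mxE.
rewrite (partial_comp (@hP i) (is_derive1_ln hP0)) powR_inv1 ?(ltW hP0)//.
by rewrite mulrC mulrN.
Qed.

Lemma estimator_coord q M om i : estimator pz py theta Zs q M om 0 i =
  sample_mean Zs (fun z => - py theta z * score z 0 i) M om *
  sample_mean Zs (py theta) M om `^ (- q).
Proof.
rewrite /estimator !mxE powRN mulrC; congr (_ * _).
rewrite /sample_mean; congr (_ * _); rewrite summxE.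
by apply: eq_bigr => m _; rewrite gm_coord.
Qed.

Lemma estimator_coord_ae q M om i : (forall m, 0 < pz theta (Zs m om)) ->
  estimator pz py theta Zs q M om 0 i =
  sample_mean Zs (gt i) M om * sample_mean Zs wt M om `^ (- q).
Proof.
move=> z0; rewrite estimator_coord; congr (_ * _ `^ _).
  by congr (_ * _); apply: eq_bigr => m _; rewrite /gt z0.
by congr (_ * _); apply: eq_bigr => m _; rewrite /wt z0.
Qed.

Lemma Evec_estimator q M i : Evec Pr (estimator pz py theta Zs q M) 0 i =
  Ex (fun om => sample_mean Zs (gt i) M om * sample_mean Zs wt M om `^ (- q)).
Proof.
rewrite mxE unlock; apply: ae_eq_Ex.
- rewrite (_ : (fun om => _) = fun om =>
    sample_mean Zs (fun z => - py theta z * score z 0 i) M om *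
    sample_mean Zs (py theta) M om `^ (- q)).
    apply: measurable_funM; first exact: (measurable_sample_mean Zs_meas).
    exact: (measurable_sample_powR Zs_meas).
  by apply/funext => om; rewrite -estimator_coord.
- apply: measurable_funM; first exact: (measurable_sample_mean Zs_meas).
  exact: (measurable_sample_powR Zs_meas).
- by apply: filterS ae_latent_gt0 => om; exact: estimator_coord_ae.
Qed.

Lemma Ex_wm : fine 'E_Pr[wm py theta Zs 0%N] = P.
Proof.
rewrite unlock -Ex_wt; apply: ae_eq_Ex.
- exact: (measurable_Zs Zs_meas (py theta)).
- exact: (measurable_Zs Zs_meas wt).
- by apply: filterS ae_latent_gt0 => om /(_ 0%N) z0; rewrite /wt z0.
Qed.

Lemma variance_wm : fine 'V_Pr[wm py theta Zs 0%N] =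
  Ex (fun om => (wt (Zs 0%N om) - P) ^+ 2).
Proof.
rewrite /variance (unlock covariance_unlockable) Ex_wm unlock; apply: ae_eq_Ex.
- exact: (measurable_Zs Zs_meas (fun z => (py theta z - P) * (py theta z - P))).
- exact: (measurable_Zs Zs_meas (fun z => (wt z - P) ^+ 2)).
- by apply: filterS ae_latent_gt0 => om /(_ 0%N) z0; rewrite /wt z0.
Qed.

Lemma L1_gt_dev i : L1 (fun om => gt i (Zs 0%N om) * (wt (Zs 0%N om) - P)).
Proof.
apply: (L1_le _ (L1_gt i)).
  exact: (measurable_Zs Zs_meas (fun z => gt i z * (wt z - P))).
move=> om; rewrite normrM ler_piMr//; apply: itv_dist_le1 heps (wt_itv _) _.
rewrite -Ex_wt; exact: mean_itv wt_itv.
Qed.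

Lemma L1_wt : L1 (fun om => wt (Zs 0%N om)).
Proof.
apply: (@L1_boundedZs _ _ _ Pr _ Zs_meas wt) => z.
by have /andP[ew w1] := wt_itv z; rewrite ger0_norm// (le_trans (ltW heps)).
Qed.

Lemma covariance_gm i :
  Covvec Pr (gm pz py theta Zs 0%N) (wm py theta Zs 0%N) 0 i =
  Ex (fun om => gt i (Zs 0%N om) * (wt (Zs 0%N om) - P)).
Proof.
rewrite mxE (unlock covariance_unlockable) Ex_wm.
(* The value of this centering constant is immaterial: it multiplies a factor of mean zero. *)
set a := fine ('E_Pr[fun om => gm pz py theta Zs 0%N om ord0 i]).
have -> : Ex (fun om => gt i (Zs 0%N om) * (wt (Zs 0%N om) - P)) =
    Ex (fun om => (gt i (Zs 0%N om) - a) * (wt (Zs 0%N om) - P)).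
  have Ld : L1 (fun om => wt (Zs 0%N om) - P) by apply: L1B; [exact: L1_wt|exact: L1_cst].
  under [RHS]eq_Rintegral do rewrite mulrBl.
  rewrite ExB; [|exact: L1_gt_dev|exact: L1Z].
  rewrite ExZ// ExB; [|exact: L1_wt|exact: L1_cst].
  by rewrite Ex_wt Ex_cst subrr mulr0 subr0.
rewrite unlock; apply: ae_eq_Ex.
- exact: (measurable_Zs Zs_meas
    (fun z => ((- py theta z *: score z) ord0 i - a) * (py theta z - P))).
- exact: (measurable_Zs Zs_meas (fun z => (gt i z - a) * (wt z - P))).
- by apply: filterS ae_latent_gt0 => om /(_ 0%N) z0; rewrite /gt /wt !z0 -(gm_coord 0%N).
Qed.

Lemma wt_dev_le1 z : `|wt z - P| <= 1.
Proof.
apply: itv_dist_le1 heps (wt_itv _) _; rewrite -Ex_wt; exact: mean_itv wt_itv.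
Qed.

(** Since w^2 <= w on [0, 1], the squared deviation is at most (1 - 2P) w + P^2, whose mean is P -
    P^2. *)
Lemma variance_wm_le : fine 'V_Pr[wm py theta Zs 0%N] <= P.
Proof.
rewrite variance_wm.
have Lw := L1_wt.
apply: (@le_trans _ _ (Ex (fun om => (1 - 2 * P) * wt (Zs 0%N om) + P ^+ 2))).
  apply: Ex_le => [||om].
  - apply: (@L1_boundedZs _ _ _ Pr _ Zs_meas (fun z => (wt z - P) ^+ 2)) => z.
    exact/normrX_le1/wt_dev_le1.
  - by apply: L1D; [exact: L1Z|exact: L1_cst].
  - have /andP[e1 w1] := wt_itv (Zs 0%N om).
    have w0 := le_trans (ltW heps) e1; move: (wt _) w0 w1 => x x0 x1; nra.
rewrite ExD; [|exact: L1Z|exact: L1_cst].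
by rewrite ExZ// Ex_cst Ex_wt; have := sqr_ge0 P; nra.
Qed.

(* Duality: the squared norm of the covariance is the expectation of its pairing
   with the samples, which Cauchy-Schwarz bounds pointwise. *)
Lemma enorm_covariance_le (C' : R) :
  (forall z, 0 < pz theta z -> enorm (score z) <= C') ->
  enorm (Covvec Pr (gm pz py theta Zs 0%N) (wm py theta Zs 0%N)) <= C' * P.
Proof.
move=> HC; set u := Covvec _ _ _.
have C0 : 0 <= C'.
  by have [z z0] := exists_latent; exact: le_trans (enorm_ge0 _) (HC z z0).
(* A vanishing norm is set apart because the bound on the squared norm is divided by [enorm u]. *)
have [u0|u0] := eqVneq (enorm u) 0; first by rewrite u0 mulr_ge0// ltW.
have up : 0 < enorm u by rewrite lt0r u0 enorm_ge0.
rewrite -(ler_pM2l up) -expr2 enorm_sqr.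
have -> : \sum_(i < d) u 0 i ^+ 2 = Ex (fun om =>
    \sum_(i < d) u 0 i * (gt i (Zs 0%N om) * (wt (Zs 0%N om) - P))).
  rewrite Ex_sum; last by move=> i; apply: L1Z; exact: L1_gt_dev.
  apply: eq_bigr => i _; rewrite ExZ; last exact: L1_gt_dev.
  by rewrite expr2 {2}/u covariance_gm.
rewrite -[in leRHS]Ex_wt mulrA -ExZ; last exact: L1_wt.
apply: Ex_le => [||om].
- by apply: L1_sum => i; apply: L1Z; exact: L1_gt_dev.
- by apply: L1Z; exact: L1_wt.
move: (Zs 0%N om) => z; have /andP[e1 _] := wt_itv z.
have w0 := le_trans (ltW heps) e1.
have [z0|z0] := boolP (0 < pz theta z); last first.
  rewrite big1 ?mulr_ge0 ?enorm_ge0// => i _.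
  by rewrite /gt (negbTE z0) mul0r mulr0.
have -> : \sum_(i < d) u 0 i * (gt i z * (wt z - P)) =
    wt z * - ((wt z - P) * \sum_(i < d) u 0 i * score z 0 i).
  have -> (a b c : R) : a * - (b * c) = - (a * b) * c by ring.
  rewrite mulr_sumr; apply: eq_bigr => i _.
  by rewrite /gt /wt z0; ring.
rewrite mulrC ler_wpM2r//; apply: le_trans (ler_norm _) _.
rewrite normrN normrM -[leRHS]mul1r ler_pM ?wt_dev_le1//.
(* Cauchy-Schwarz is one-sided here; [- u] supplies the lower bound of the pairing. *)
have := dot_le_enorm u (score z); have := dot_le_enorm (- u) (score z).
rewrite enormN; under eq_bigr do rewrite mxE mulNr.
rewrite sumrN => h1 h2.
have h3 : enorm u * enorm (score z) <= enorm u * C'.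
  by rewrite ler_wpM2l ?enorm_ge0// HC.
by rewrite ler_norml lerNl (le_trans h1)//= (le_trans h2).
Qed.

Definition lead_term q (M : nat) : 'rV[R]_d :=
  (q / (M%:R * P `^ (q + 1))) *:
  (((q + 1) / 2 * fine 'V_Pr[wm py theta Zs 0%N]) *: grad (ell pz py 1) theta
   - Covvec Pr (gm pz py theta Zs 0%N) (wm py theta Zs 0%N)).

(** Variance and covariance each contribute a factor [P], which cancels one power in the
    denominator; q <= 1 makes (q+1)/2 at most 1. *)
Lemma enorm_lead_term_le q C C' : 0 <= q <= 1 ->
  enorm (grad (fun th => ln (marginal pz py th)) theta) <= C ->
  (forall z, 0 < pz theta z -> enorm (score z) <= C') ->
  forall M, (0 < M)%N -> enorm (lead_term q M) <= (C + C') * (q / (M%:R * P `^ q)).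
Proof.
move=> /andP[q0 q1] HC HC' M M0.
have M1 : 0 < M%:R :> R by rewrite ltr0n.
have Pq : 0 < P `^ q by exact: powR_gt0.
have E : P `^ (q + 1) = P `^ q * P.
  by rewrite powRD ?powRr1 ?(ltW hP0)//; apply/implyP => _; rewrite lt0r_neq0.
rewrite /lead_term enormZ E ger0_norm; last first.
  by rewrite divr_ge0// !mulr_ge0// ltW.
have -> : (C + C') * (q / (M%:R * P `^ q)) =
    q / (M%:R * (P `^ q * P)) * (P * C + C' * P).
  by field; rewrite !lt0r_neq0.
rewrite ler_wpM2l//; first by rewrite divr_ge0// !mulr_ge0// ltW.
apply: le_trans (enormD _ _) _; rewrite enormN; apply: lerD; last first.
  exact: enorm_covariance_le.
rewrite enormZ grad_ell1 enormN; apply: ler_pM => //; first exact: enorm_ge0.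
have V0 : 0 <= fine 'V_Pr[wm py theta Zs 0%N].
  by rewrite variance_wm; apply: Ex_ge0 => om; exact: sqr_ge0.
rewrite ger0_norm; last by rewrite mulr_ge0// divr_ge0// addr_ge0.
apply: le_trans variance_wm_le; rewrite ler_piMl//; lra.
Qed.

Hypothesis Zs_indep : mutually_independent Pr Zs.

Lemma estimator_consistent q :
  {ae Pr, forall om, (fun M => estimator pz py theta Zs q M om) @ \oo -->
    grad (ell pz py q) theta}.
Proof.
have Lw2 : L1 (fun om => wt (Zs 0%N om) ^+ 2).
  apply: (@L1_boundedZs _ _ _ Pr _ Zs_meas (fun z => wt z ^+ 2)) => z.
  have /andP[ew w1] := wt_itv z; apply: normrX_le1.
  by rewrite ger0_norm// (le_trans (ltW heps)).
have Aw := slln Zs_meas Zs_law Zs_indep Lw2.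
have Ag : {ae Pr, forall om, forall i : 'I_d, sample_mean Zs (gt i) ^~ om @ \oo -->
    Ex (fun om => gt i (Zs 0%N om))}.
  by apply: filter_forall => i; exact: (slln Zs_meas Zs_law Zs_indep (L1_gt_sqr i)).
apply: filterS3 ae_latent_gt0 Aw Ag => om z0 hwt hgt.
apply: cvg_rV => i; rewrite grad_ell.
under eq_fun do rewrite estimator_coord_ae//.
apply: cvgM; first exact: hgt.
rewrite Ex_wt in hwt.
apply: (@continuous_cvg _ _ _ _ _ _ (fun x => x `^ (- q)) P) hwt.
apply: differentiable_continuous; apply/derivable1_diffP.
by apply: derivable_powR; rewrite in_itv/= hP0.
Qed.

Lemma estimator_bias q : exists K M0, forall M, (M0 <= M)%N ->
  enorm (Evec Pr (estimator pz py theta Zs q M) - grad (ell pz py q) theta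
    - lead_term q M) <= K / M%:R ^+ 2.
Proof.
have expand i := ratio_mean_expansion Zs_meas Zs_law Zs_indep heps wt_itv (L1_gt i) (- q).
have /fin_all_exists[K HK] : forall i, exists K, forall M, (0 < M)%N ->
    `|(Evec Pr (estimator pz py theta Zs q M) - grad (ell pz py q) theta
    - lead_term q M) 0 i| <= K * M%:R^-1 ^+ 2.
  move=> i; have [K _ HK] := expand i; exists K => M M0.
  apply: le_trans (HK M M0); rewrite le_eqVlt; apply/orP; left; apply/eqP.
  have subE (A B : 'rV[R]_d) : (A - B) 0 i = A 0 i - B 0 i by rewrite !mxE.
  have scaleE a (A : 'rV[R]_d) : (a *: A) 0 i = a * A 0 i by rewrite mxE.
  congr `|_|; rewrite Ex_wt !subE Evec_estimator grad_ell.
  rewrite -addrA -opprD; congr (_ - (_ + _)).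
  rewrite /lead_term scaleE subE scaleE covariance_gm grad_ell variance_wm.
  have Pp : 0 < P `^ (q + 1) by exact: powR_gt0.
  have E1 : P `^ (- q - 1) = (P `^ (q + 1))^-1 by rewrite -opprD powRN.
  (* The quadratic Taylor coefficient carries P^(-q-2); its extra 1/P turns the mean of the gradient
     samples into the gradient of [ell] at exponent 1. *)
  have E2 : P `^ (- q - 1 - 1) = (P `^ (q + 1))^-1 / P.
    rewrite powRB ?E1 ?powRr1 ?(ltW hP0)//.
    by apply/implyP => _; rewrite lt0r_neq0.
  rewrite E1 E2 powR_inv1 ?(ltW hP0)//.
  have M1 : 0 < M%:R :> R by rewrite ltr0n.
  by field; rewrite !lt0r_neq0.
exists (Num.sqrt (\sum_(i < d) K i ^+ 2)), 1%N => M M0.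
rewrite -exprVn; apply: enorm_le_sqrt => [|i]; last exact: HK.
by rewrite exprn_ge0// invr_ge0.
Qed.

Lemma estimator0_unbiased M : (0 < M)%N ->
  Evec Pr (estimator pz py theta Zs 0 M) = grad (ell pz py 0) theta.
Proof.
move=> M0; apply/rowP => i; rewrite Evec_estimator grad_ell oppr0 powRr0 mulr1.
under eq_Rintegral do rewrite powRr0 mulr1.
have Lm m : L1 (fun om => gt i (Zs m om)) by exact: (L1_iid Zs_meas Zs_law m (L1_gt i)).
rewrite /sample_mean ExZ; last exact: L1_sum_ord.
rewrite Ex_sum//.
under eq_bigr do rewrite (Ex_iid Zs_meas Zs_law 0%N (Lm _)).
rewrite sumr_const card_ord -[X in _ * X]mulr_natl mulKf//.
by rewrite pnatr_eq0 -lt0n.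
Qed.

End model.

Theorem mainTheorem11
  (R : realType) (d : nat)
  (* model: pz th z = p_theta(z | x_star), py th z = p_theta(y_star | x_star, z) *)
  (pz py : 'rV[R]_d -> nat -> R)
  (pz_ge0 : forall th z, 0 <= pz th z)
  (pz_sum1 : forall th, (\sum_(0 <= z <oo) (pz th z)%:E = 1)%E)
  (py_01 : forall th z, 0 <= py th z <= 1)
  (* the parameter point and q in [0,1] *)
  (theta : 'rV[R]_d) (q : R) (hq : 0 <= q <= 1)
  (* i.i.d. samples z^(1), z^(2), ... ~ p_theta(. | x_star) *)
  (dO : measure_display) (Omega : measurableType dO) (Pr : probability Omega R)
  (Zs : nat -> Omega -> nat)
  (Zs_meas : forall m (A : set nat), measurable (Zs m @^-1` A))
  (Zs_law : forall m z, Pr (Zs m @^-1` [set z]) = (pz theta z)%:E)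
  (Zs_indep : mutually_independent Pr Zs)
  (* differentiability, and interchange of differentiation and summation *)
  (hJ : forall z, partials_exist (fun th => joint pz py th z) theta)
  (hP : partials_exist (marginal pz py) theta)
  (hswap : forall i : 'I_d,
     series (fun z => partial i (fun th => joint pz py th z) theta) @ \oo
       --> partial i (marginal pz py) theta)
  (* (1) P_theta > 0 *)
  (hP0 : 0 < marginal pz py theta)
  (* (2) E ||g_m||^2 < oo *)
  (hg2 : forall m,
     ('E_Pr[fun om => (enorm (gm pz py theta Zs m om) ^+ 2)%R] < +oo)%E)
  (* (3) w_m >= eps almost surely, for some eps > 0 *)
  (eps : R) (heps : 0 < eps)
  (hw : forall m, {ae Pr, forall om, eps <= wm py theta Zs m om}) :
  let P := marginal pz py theta in
  let est := estimator pz py theta Zs q in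
  let grad_lq := grad (ell pz py q) theta in
  let grad_l1 := grad (ell pz py 1) theta in
  let Varw := fine ('V_Pr[wm py theta Zs 0%N]) in
  let Covgw := Covvec Pr (gm pz py theta Zs 0%N) (wm py theta Zs 0%N) in
  let lead := fun M : nat =>
     (q / (M%:R * P `^ (q + 1))) *: (((q + 1) / 2 * Varw) *: grad_l1 - Covgw) in
  (* almost sure consistency *)
  {ae Pr, forall om, (fun M => est M om) @ \oo --> grad_lq}
  (* bias expansion: E[est] - grad ell_q = lead M + O(M^-2) *)
  /\ (exists (K : R) (M0 : nat), forall M : nat, (M0 <= M)%N ->
        enorm (Evec Pr (est M) - grad_lq - lead M) <= K / (M%:R ^+ 2))
  (* bound on the leading term *)
  /\ (forall C C' : R,
        enorm (grad (fun th => ln (marginal pz py th)) theta) <= C ->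
        (forall z, 0 < pz theta z ->
           enorm (grad (fun th => ln (joint pz py th z)) theta) <= C') ->
        forall M : nat, (0 < M)%N ->
          enorm (lead M) <= (C + C') * (q / (M%:R * P `^ q)))
  (* q = 0: exactly unbiased for every M *)
  /\ (q = 0 -> forall M : nat, (0 < M)%N -> Evec Pr (est M) = grad_lq).
Proof.
move=> P est grad_lq grad_l1 Varw Covgw lead.
split; first exact: (estimator_consistent pz_ge0 pz_sum1 py_01 Zs_meas Zs_law
  hJ hP hswap hP0 hg2 heps hw Zs_indep q).
split; first exact: (estimator_bias pz_ge0 pz_sum1 py_01 Zs_meas Zs_law hJ hP
  hswap hP0 hg2 heps hw Zs_indep q).
split => [C C' HC HC' M M0|q0 M M0].
  exact: (enorm_lead_term_le pz_ge0 pz_sum1 py_01 Zs_meas Zs_law hJ hP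
    hswap hP0 hg2 heps hw hq HC HC' M0).
rewrite /est /grad_lq q0.
exact: (estimator0_unbiased pz_ge0 py_01 Zs_meas Zs_law hJ hP
  hswap hP0 hg2 heps hw M0).
Qed.
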